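(* The map $\pi:\mathfrak{Z}\to\mathfrak{D}$, the composite of the inclusion $\mathfrak{Z}\hookrightarrow\mathfrak{U}^{\mathfrak{k}}$ and the quotient $\mathfrak{U}^{\mathfrak{k}}\to\mathfrak{D}$, is surjective. In particular, for every $(p,q)$-hook partition $\mu$ there exists $Z_\mu\in\mathfrak{Z}$ with $\pi(Z_\mu)=\mathscr{D}_\mu$.
   Context: Over $\mathbb{C}$, fix $p,q\ge1$, $\mathfrak{g}=\mathfrak{gl}(2p|2q)$ with even indices $1..2p$ and odd indices $2p+1..2p+2q$. Let $J=\tfrac12\mathrm{diag}(I_p,-I_p,I_q,-I_q)$; the $\mathrm{ad}J$-eigenspaces for $-1,0,1$ are $\mathfrak{p}^-,\mathfrak{k},\mathfrak{p}^+$, with $\mathfrak{k}\cong\mathfrak{gl}(p|q)\oplus\mathfrak{gl}(p|q)$. $\mathfrak{U}=\mathfrak{U}(\mathfrak{g})$, $\mathfrak{Z}$ its center, $\mathfrak{D}=\mathfrak{U}^{\mathfrak{k}}/(\mathfrak{U}\mathfrak{k})^{\mathfrak{k}}$. $(p,q)$-hook partitions are partitions $\lambda$ with $\lambda_{p+1}\le q$. For such $\lambda$, $W_\lambda=L(\lambda^\natural)\otimes L(\lambda^\natural)^*$ where $L(\lambda^\natural)$ is the irreducible $\mathfrak{gl}(p|q)$-module of standard-Borel highest weight $\sum_i\lambda_i\epsilon_i+\sum_j\max(\lambda'_j-p,0)\delta_j$ (second copy of $\mathfrak{gl}(p|q)$ acting contragrediently on the dual); $W_\lambda$ occurs exactly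 once in $\mathfrak{S}(\mathfrak{p}^+)$ and $W_\lambda^*$ exactly once in $\mathfrak{S}(\mathfrak{p}^-)$ (dual via the form $\tfrac1{m!}b^{\otimes m}$, $b(X,Y)=\tfrac12\mathrm{str}(XY)$). $D_\lambda=\sum_i\xi_i\eta_i\in\mathfrak{U}^{\mathfrak{k}}$ with $\{\eta_i\}$ a homogeneous basis of $W_\lambda\subseteq\mathfrak{S}(\mathfrak{p}^+)$ and $\{\xi_i\}$ the dual basis of $W_\lambda^*\subseteq\mathfrak{S}(\mathfrak{p}^-)$; $\mathscr{D}_\lambda$ is the image of $D_\lambda$ in $\mathfrak{D}$. *)

(* Defs.v *)
From HB Require Import structures.
From mathcomp Require Import all_boot all_algebra.
From mathcomp Require Import complex.
From mathcomp Require Import Rstruct.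
From mathcomp Require Import finmap monalg.
Set Implicit Arguments. Unset Strict Implicit. Unset Printing Implicit Defensive.
Import GRing.Theory.
Local Open Scope ring_scope.

Definition C : fieldType := complex Rdefinitions.R.

Section GL.
Variables p q : nat.

(* gl(2p|2q): indices 0..2p+2q-1; even indices are 0..2p-1, odd ones 2p..2p+2q-1
   (0-based version of 1..2p and 2p+1..2p+2q). *)
Definition glN : nat := (p + p) + (q + q).
Definition Idx : finType := 'I_glN.
(* index of the basis element E_ij of gl(2p|2q) *)
Definition Gen : finType := (Idx * Idx)%type.

Definition ipar (i : Idx) : bool := (p + p <= i)%N.
Definition gpar (a : Gen) : bool := ipar a.1 (+) ipar a.2.
Definition sgn (b : bool) : C := if b then -1 else 1.

Definition FA := {malg C[{fmonom Gen}]}.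
Definition X (a : Gen) : FA := << fmu a >>.

Definition wpar (w : {fmonom Gen}) : bool := foldr (fun a b => gpar a (+) b) false w.
Definition parity_aut (f : FA) : FA :=
  \sum_(w <- msupp f) (sgn (wpar w) * f@_w) *: << w >>.

Definition sbr (a : Gen) (u : FA) : FA :=
  X a * u - (if gpar a then parity_aut u else u) * X a.

Definition glbr (a b : Gen) : FA :=
  (if a.2 == b.1 then X (a.1, b.2) else 0)
  - sgn (gpar a && gpar b) *: (if b.2 == a.1 then X (b.1, a.2) else 0).

Definition Urel (a b : Gen) : FA :=
  X a * X b - sgn (gpar a && gpar b) *: (X b * X a) - glbr a b.

(* two-sided ideal generated by the relations; U = FA / Iideal *)
Inductive Iideal : FA -> Prop :=
| Iideal0 : Iideal 0
| Iideal_gen (f g : FA) (a b : Gen) : Iideal (f * Urel a b * g)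
| IidealD (x y : FA) : Iideal x -> Iideal y -> Iideal (x + y).

(* J = 1/2 diag(I_p, -I_p, I_q, -I_q): Jpos i <-> J_ii = +1/2 *)
Definition Jpos (i : Idx) : bool :=
  ((i < p)%N || ((p + p <= i)%N && (i < p + p + q)%N)).
(* k = 0-eigenspace of ad J, spanned by E_ij with J_ii = J_jj *)
Definition inK (a : Gen) : bool := Jpos a.1 == Jpos a.2.

(* (representatives of) the center Z of U: ad g - invariants *)
Definition inZ (z : FA) : Prop := forall a : Gen, Iideal (sbr a z).
Definition inUk_inv (u : FA) : Prop := forall a : Gen, inK a -> Iideal (sbr a u).
Definition inUK (u : FA) : Prop :=
  exists f : Gen -> FA, Iideal (u - \sum_(a : Gen | inK a) f a * X a).
Definition inUKk (u : FA) : Prop := inUk_inv u /\ inUK u.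

(* pi : Z -> D = U^k / (Uk)^k is surjective: every class in D has a preimage *)
Definition pi_surjective : Prop :=
  forall u : FA, inUk_inv u -> exists z : FA, inZ z /\ inUKk (u - z).
End GL.

(* Main.v *)
Require Import Defs.
From mathcomp Require Import all_boot all_algebra.
From mathcomp Require Import all_fingroup complex Rstruct finmap monalg.
Set Implicit Arguments. Unset Strict Implicit. Unset Printing Implicit Defensive.
Import GRing.Theory.
Local Open Scope ring_scope.

(* The space D is filtered by word length, and a central element only has to match
   an element u of U^k in its leading part, modulo lower filtration and Uk.
   Let V be the natural module of gl(2p|2q).  Acting by a word of length d on the
   k-invariant vector J (x) ... (x) J of End(V)^{(x)d} and keeping the component
   in which every tensor slot anticommutes with J gives a multiple of the
   symmetrisation of that word, and kills shorter words.  This replaces the PBW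
   theorem: the leading part of u in U^k is the image of an operator M on V^{(x)d}
   that commutes with k.  By the double commutant theorem for the finite group
   generated by the super permutations and by J in each slot, M is a combination
   of these group elements; modulo lower terms the J factors can be absorbed by
   conjugation, and what remains is a combination of super permutations.  These
   commute with all of gl(2p|2q), so their images in U are central. *)

(** Without PBW the leading symbol of [u] has no a priori meaning. It is read off from [act u jj]
    instead, which depends only on the class of [u] in U/Uk, since the relations and Uk kill [jj].
    With J rescaled to an involution, [E_a, J] is 2 E_a J for E_a in p^+ + p^- and 0 for E_a in k.
    To exchange the eigenspaces of J in all d slots, a word of length d must spend one letter per
    slot: hence the factor 2^d and the vanishing on shorter words. The way back is the
    multiplication map [phi] from End(V)^{(x)d} = gl^{(x)d} to U. It is exactly equivariant, so
    invariant operators give central elements, but it respects permutations of the slots only modulo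
    shorter words. Hence the congruences modulo [low d] and the induction on d, which goes on with u
    - z. The double commutant theorem needs M to commute with all invariants of the finite group,
    while only commutation with k is known. The gap closes because these invariants are polynomials
    in the operators by which k acts. *)

Lemma sgnD b c : sgn (b (+) c) = sgn b * sgn c.
Proof. by case: b; case: c; rewrite /= ?mulr1 ?mul1r ?mulrNN ?mulr1. Qed.

Lemma XE p q (a : Gen p q) : X a = << fmu a >>.
Proof. by []. Qed.

Local Opaque Defs.X mkmalgU fgmul fgadd fgopp fgscale fgone fgzero mcoeff msupp.

Section MonoidAlgebra.
Variables (K : monomType) (R : comNzRingType).

Lemma malg_scaleU c (w : K) : << c *g w >> = c *: << w >> :> {malg R[K]}.
Proof. by apply/malgP=> k; rewrite mcoeffZ !mcoeffU mulrnAr mulr1. Qed.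

Lemma malg_scaleAr c (f g : {malg R[K]}) : f * (c *: g) = c *: (f * g).
Proof.
have cf : f * c%:MP = c%:MP * f.
  rewrite [LHS]fgmulgU [RHS]fgmulUg; apply: eq_bigr => w _.
  by rewrite mulm1 mul1m mulrC.
by rewrite -(mul_malgC c g) -(mul_malgC c (f * g)) mulrA cf mulrA.
Qed.

End MonoidAlgebra.

Lemma quad_aux (A : lalgType C) (x y z g : A) (e : C) :
  x * (y * z) - e *: (y * (x * z)) = (x * y - e *: (y * x) - g) * z + g * z.
Proof. by rewrite -mulrDl subrK mulrBl -scalerAl !mulrA. Qed.

Lemma leibniz_aux (A : lalgType C) (x y z z' g : A) (e : C) :
  x * (y * z) - e *: (y * z') * x - (g * z + e *: (y * (x * z - z' * x))) =
  (x * y - e *: (y * x) - g) * z.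
Proof.
rewrite !mulrBl mulrBr scalerBr -!scalerAl !mulrA.
set u := x * y * z; set v := _ *: _; set w := _ *: _; set t := g * z.
by rewrite opprD opprB !addrA (addrAC (u - v)) subrK addrAC.
Qed.

(** * The free algebra and its filtration *)

Section FreeAlgebra.
Variables p q : nat.
Local Notation Gen := (Gen p q).
Local Notation FA := (FA p q).
Local Notation I := (@Iideal p q).
Local Notation X := (@X p q).
Local Notation sbr := (@sbr p q).
Local Notation glbr := (@glbr p q).
Local Notation Urel := (@Urel p q).
Local Notation parity_aut := (@parity_aut p q).
Local Notation wpar := (@wpar p q).
Local Notation inUK := (@inUK p q).

Section LinearExtension.
Variables (V : lmodType C) (h : {fmonom Gen} -> V).

Definition mlin (f : FA) : V := \sum_(w <- msupp f) f@_w *: h w.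

Lemma mlinEw (d : {fset {fmonom Gen}}) (f : FA) : (msupp f `<=` d)%fset ->
  mlin f = \sum_(w <- d) f@_w *: h w.
Proof.
move=> /fsubsetP sfd; apply: big_fset_incl => [|w _]; first exact/fsubsetP.
by rewrite -mcoeff_eq0 => /eqP ->; rewrite scale0r.
Qed.

Lemma mlinD f g : mlin (f + g) = mlin f + mlin g.
Proof.
rewrite (@mlinEw (msupp f `|` msupp g)%fset) ?msuppD_le //.
rewrite (@mlinEw (msupp f `|` msupp g)%fset f) ?fsubsetUl //.
rewrite (@mlinEw (msupp f `|` msupp g)%fset g) ?fsubsetUr //.
by rewrite -big_split /=; apply: eq_bigr => w _; rewrite mcoeffD scalerDl.
Qed.

Lemma mlinZ c f : mlin (c *: f) = c *: mlin f.
Proof.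
rewrite (@mlinEw (msupp f)) ?msuppZ_le // scaler_sumr.
by apply: eq_bigr => w _; rewrite mcoeffZ scalerA.
Qed.

Lemma mlin0 : mlin 0 = 0.
Proof. by rewrite /mlin msupp0 big_nil. Qed.

Lemma mlin_sum (J : Type) (r : seq J) (P : pred J) (F : J -> FA) :
  mlin (\sum_(i <- r | P i) F i) = \sum_(i <- r | P i) mlin (F i).
Proof. by apply: (big_morph mlin mlinD mlin0). Qed.

Lemma mlinU w : mlin << w >> = h w.
Proof. by rewrite /mlin msuppU1 big_seq_fset1 mcoeffUU scale1r. Qed.

End LinearExtension.

Lemma mlin_id (f : FA) : f = mlin (fun w => << w >>) f.
Proof.
rewrite {1}(monalgE f) /mlin; apply: eq_bigr => w _.
exact: malg_scaleU.
Qed.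

Lemma FAscaleAr c (f g : FA) : f * (c *: g) = c *: (f * g).
Proof. exact: malg_scaleAr. Qed.

Definition Xword (s : seq Gen) : FA := \prod_(a <- s) X a.
Local Notation XX := Xword.

Lemma XX_mon (w : {fmonom Gen}) : << w >> = XX w :> FA.
Proof.
case: w => s /=; rewrite /XX; elim: s => [|a s IH]; first by rewrite big_nil -fmoneE.
rewrite big_cons -IH XE malgM_def fgmulUU mulr1.
by congr << _ >>; rewrite /mmul /= fmmulE fmuE.
Qed.

Lemma XX_cat s t : XX (s ++ t) = XX s * XX t.
Proof. by rewrite /XX big_cat. Qed.

Lemma XX_cons a s : XX (a :: s) = X a * XX s.
Proof. by rewrite /XX big_cons. Qed.

Lemma FAE (f : FA) : f = \sum_(w <- msupp f) f@_w *: XX w.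
Proof. by rewrite {1}(mlin_id f); apply: eq_bigr => w _; rewrite XX_mon. Qed.

Lemma mlinXX (V : lmodType C) (h : {fmonom Gen} -> V) s : mlin h (XX s) = h (FMonom s).
Proof. by rewrite -(XX_mon (FMonom s)) mlinU. Qed.

Lemma FA_ext (V : lmodType C) (u v : FA -> V) :
  (forall f g, u (f + g) = u f + u g) -> (forall c f, u (c *: f) = c *: u f) ->
  (forall f g, v (f + g) = v f + v g) -> (forall c f, v (c *: f) = c *: v f) ->
  (forall s, u (XX s) = v (XX s)) -> u =1 v.
Proof.
move=> uD uZ vD vZ uv f.
have u0 : u 0 = 0 by rewrite -(scale0r (0 : FA)) uZ scale0r.
have v0 : v 0 = 0 by rewrite -(scale0r (0 : FA)) vZ scale0r.
rewrite (FAE f) (big_morph u uD u0) (big_morph v vD v0).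
by apply: eq_bigr => w _; rewrite uZ vZ uv.
Qed.

Lemma idealD x y : I x -> I y -> I (x + y). Proof. exact: IidealD. Qed.

Lemma idealMl f x : I x -> I (f * x).
Proof.
elim=> [|g h a b|y z _ Iy _ Iz]; first by rewrite mulr0; apply: Iideal0.
  by rewrite !mulrA; apply: Iideal_gen.
by rewrite mulrDr; apply: IidealD.
Qed.

Lemma idealMr f x : I x -> I (x * f).
Proof.
elim=> [|g h a b|y z _ Iy _ Iz]; first by rewrite mul0r; apply: Iideal0.
  by rewrite -mulrA; apply: Iideal_gen.
by rewrite mulrDl; apply: IidealD.
Qed.

Lemma idealZ c x : I x -> I (c *: x).
Proof. by rewrite -mul_malgC; apply: idealMl. Qed.

Lemma ideal_Urel a b : I (Urel a b).
Proof. by rewrite -[Urel a b]mulr1 -[Urel a b]mul1r; apply: Iideal_gen. Qed.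

Lemma UK_ideal x : I x -> inUK x.
Proof.
move=> Ix; exists (fun=> 0).
by rewrite big1 ?subr0 // => a _; rewrite mul0r.
Qed.

Lemma UKD x y : inUK x -> inUK y -> inUK (x + y).
Proof.
move=> [f If] [g Ig]; exists (fun a => f a + g a).
under eq_bigr do rewrite mulrDl.
rewrite big_split opprD addrACA; exact: idealD If Ig.
Qed.

Lemma UKZ c x : inUK x -> inUK (c *: x).
Proof.
move=> [f If]; exists (fun a => c *: f a).
under eq_bigr do rewrite -scalerAl.
by rewrite -scaler_sumr -scalerBr; exact: idealZ If.
Qed.

Lemma UK_mulX f a : inK a -> inUK (f * X a).
Proof.
move=> Ka; exists (fun b => if b == a then f else 0).
rewrite (bigD1 a) //= eqxx big1 => [|b /andP[_ /negbTE ->]]; last by rewrite mul0r.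
by rewrite addr0 subrr; apply: Iideal0.
Qed.

(* Spanned by the words of length < d; the strict inequality makes [filt 0] zero. *)
Definition filt d (f : FA) := forall w, f@_w != 0 -> (size (w : seq Gen) < d)%N.

Lemma filt0 d : filt d 0.
Proof. by move=> w; rewrite mcoeff0 eqxx. Qed.

Lemma filtD d f g : filt d f -> filt d g -> filt d (f + g).
Proof.
move=> Ff Fg w; rewrite mcoeffD; have [f0|/Ff //] := eqVneq f@_w 0.
by rewrite f0 add0r => /Fg.
Qed.

Lemma filtZ d c f : filt d f -> filt d (c *: f).
Proof. by move=> Ff w; rewrite mcoeffZ mulf_eq0 negb_or => /andP[_ /Ff]. Qed.

Lemma filt_sum d (J : eqType) (r : seq J) (P : pred J) (F : J -> FA) :
  (forall i, i \in r -> P i -> filt d (F i)) -> filt d (\sum_(i <- r | P i) F i).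
Proof.
move=> IF; rewrite big_seq_cond; apply: big_ind => [||i /andP[ri Pi]].
- exact: filt0.
- exact: filtD.
- exact: IF.
Qed.

Lemma filt_XX d s : (size s < d)%N -> filt d (XX s).
Proof.
move=> sd w; rewrite -(XX_mon (FMonom s)) mcoeffU1.
by case: (FMonom s =P w) => [<-|_]; rewrite ?eqxx.
Qed.

Lemma filt_supp d f w : filt d f -> w \in msupp f -> (size (w : seq Gen) < d)%N.
Proof. by move=> Ff; rewrite -mcoeff_neq0; apply: Ff. Qed.

Lemma filt_Ml d a f : filt d f -> filt d.+1 (X a * f).
Proof.
move=> Ff; rewrite (FAE f) mulr_sumr; apply: filt_sum => w wf _.
rewrite FAscaleAr -XX_cons; apply/filtZ/filt_XX; exact: (filt_supp Ff).
Qed.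

(* Congruence modulo shorter words in U, and in U / Uk for [low]. *)
Definition lowI d (x : FA) := exists2 y, filt d y & I (x - y).
Definition low d (x : FA) := exists2 y, filt d y & inUK (x - y).

Lemma lowI_low d x : lowI d x -> low d x.
Proof. by case=> y Fy Iy; exists y => //; apply: UK_ideal. Qed.

Lemma lowID d x y : lowI d x -> lowI d y -> lowI d (x + y).
Proof.
move=> [x' Fx Ix] [y' Fy Iy]; exists (x' + y'); first exact: filtD.
by rewrite opprD addrACA; exact: idealD Ix Iy.
Qed.

Lemma lowIZ d c x : lowI d x -> lowI d (c *: x).
Proof.
move=> [x' Fx Ix]; exists (c *: x'); first exact: filtZ.
by rewrite -scalerBr; apply: idealZ.
Qed.

Lemma lowI_ideal d x : I x -> lowI d x.
Proof. by move=> Ix; exists 0; [exact: filt0 | rewrite subr0]. Qed.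

Lemma lowI_filt d x : filt d x -> lowI d x.
Proof. by move=> Fx; exists x => //; rewrite subrr; apply: Iideal0. Qed.

Lemma lowI_Ml d a x : lowI d x -> lowI d.+1 (X a * x).
Proof.
move=> [y Fy Iy]; exists (X a * y); first exact: filt_Ml.
by rewrite -mulrBr; apply: idealMl.
Qed.

Lemma lowD d x y : low d x -> low d y -> low d (x + y).
Proof.
move=> [x' Fx Ix] [y' Fy Iy]; exists (x' + y'); first exact: filtD.
by rewrite opprD addrACA; exact: UKD Ix Iy.
Qed.

Lemma lowZ d c x : low d x -> low d (c *: x).
Proof.
move=> [x' Fx Ix]; exists (c *: x'); first exact: filtZ.
by rewrite -scalerBr; apply: UKZ.
Qed.

Lemma low_filt d x : filt d x -> low d x.
Proof. by move=> Fx; apply/lowI_low/lowI_filt. Qed.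

Lemma low_UK d x : inUK x -> low d x.
Proof. by move=> Kx; exists 0; [exact: filt0 | rewrite subr0]. Qed.

Lemma low0 d : low d 0. Proof. exact/low_filt/filt0. Qed.

Lemma low_sum d (J : eqType) (r : seq J) (P : pred J) (F : J -> FA) :
  (forall i, i \in r -> P i -> low d (F i)) -> low d (\sum_(i <- r | P i) F i).
Proof.
move=> IF; rewrite big_seq_cond; apply: big_ind => [||i /andP[ri Pi]].
- exact: low0.
- exact: lowD.
- exact: IF.
Qed.

Lemma lowN d x : low d x -> low d (- x).
Proof. by rewrite -scaleN1r; apply: lowZ. Qed.

Lemma low_trans d y x z : low d (x - y) -> low d (y - z) -> low d (x - z).
Proof. by move=> lxy lyz; rewrite -(subrK y x) -addrA; apply: lowD. Qed.

Lemma lowI_trans d y x z : lowI d (x - y) -> lowI d (y - z) -> lowI d (x - z).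
Proof. by move=> lxy lyz; rewrite -(subrK y x) -addrA; apply: lowID. Qed.

(** The correction is [glbr a b * XX s], a combination of words with one letter fewer than the two
    exchanged words, whose length is [(size s).+2]. *)
Lemma lowI_swap a b s :
  lowI (size s).+2 (X a * (X b * XX s) - sgn (gpar a && gpar b) *: (X b * (X a * XX s))).
Proof.
set e := sgn _.
rewrite (quad_aux (X a) (X b) (XX s) (glbr a b) e).
apply: lowID; first exact/lowI_ideal/idealMr/ideal_Urel.
apply: lowI_filt; rewrite /glbr mulrBl; apply: filtD.
  by case: ifP => _; [rewrite -XX_cons; apply: filt_XX | rewrite mul0r; apply: filt0].
rewrite -scaleN1r; apply: filtZ; rewrite -scalerAl; apply: filtZ.
by case: ifP => _; [rewrite -XX_cons; apply: filt_XX | rewrite mul0r; apply: filt0].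
Qed.

Lemma parity_autE : parity_aut =1 mlin (fun w => sgn (wpar w) *: << w >>).
Proof. by move=> f; apply: eq_bigr => w _; rewrite scalerA mulrC. Qed.

Lemma parity_autD f g : parity_aut (f + g) = parity_aut f + parity_aut g :> FA.
Proof. by rewrite !parity_autE mlinD. Qed.

Lemma parity_autZ c f : parity_aut (c *: f) = c *: parity_aut f :> FA.
Proof. by rewrite !parity_autE mlinZ. Qed.

Lemma parity_aut_cons b s :
  parity_aut (XX (b :: s)) = sgn (gpar b) *: (X b * parity_aut (XX s)).
Proof.
by rewrite !parity_autE !mlinXX sgnD !XX_mon /= XX_cons FAscaleAr scalerA.
Qed.

Lemma sbrD a f g : sbr a (f + g) = sbr a f + sbr a g.
Proof.
rewrite /sbr mulrDr; case: ifP => _; rewrite ?parity_autD mulrDl opprD;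
by rewrite addrACA.
Qed.

Lemma sbrZ a c f : sbr a (c *: f) = c *: sbr a f.
Proof. by rewrite /sbr; case: ifP => _; rewrite ?parity_autZ FAscaleAr -scalerAl scalerBr. Qed.

Lemma sbr0 a : sbr a 0 = 0.
Proof. by move: (sbrZ a 0 0); rewrite !scale0r. Qed.

Lemma sbr1 a : sbr a (XX [::]) = 0.
Proof.
rewrite /sbr; have -> : parity_aut (XX [::]) = XX [::].
  by rewrite parity_autE mlinXX /wpar /= scale1r XX_mon.
by rewrite if_same /XX big_nil mulr1 mul1r subrr.
Qed.

(** Super Leibniz rule; the error is exactly [Urel a b * XX s], so the rule holds in U. *)
Lemma sbr_cons a b s :
  I (sbr a (XX (b :: s)) -
     (glbr a b * XX s + sgn (gpar a && gpar b) *: (X b * sbr a (XX s)))).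
Proof.
set e := sgn _; have -> : sbr a (XX (b :: s)) - (glbr a b * XX s + e *: (X b * sbr a (XX s)))
    = Urel a b * XX s.
  rewrite /sbr XX_cons.
  have -> : (if gpar a then parity_aut (X b * XX s) else X b * XX s) =
            e *: (X b * (if gpar a then parity_aut (XX s) else XX s)).
    rewrite /e; case: (gpar a); rewrite /= ?scale1r // -XX_cons.
    exact: parity_aut_cons.
  exact: leibniz_aux.
exact/idealMr/ideal_Urel.
Qed.

End FreeAlgebra.

(** * Operators on super tensor powers *)

Section SuperTensors.
Variables (F : fieldType) (T : finType) (par : T -> bool) (d : nat).
Local Notation word := {ffun 'I_d -> T}.
Local Notation Gn := (T * T)%type.
Local Notation mtx := 'M[F]_#|{ffun 'I_d -> T}|.

Definition bsgn (b : bool) : F := if b then -1 else 1.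
Local Notation sg := bsgn.
Definition gen_par (a : Gn) : bool := par a.1 (+) par a.2.
Local Notation gp := gen_par.

Lemma sgD b c : sg (b (+) c) = sg b * sg c.
Proof. by case: b; case: c; rewrite /= ?mulr1 ?mul1r ?mulrNN ?mulr1. Qed.

Lemma sg_sq b : sg b * sg b = 1.
Proof. by rewrite -sgD addbb. Qed.

Lemma ltn_ordC (k l : 'I_d) : k != l -> (l < k)%N = ~~ (k < l)%N.
Proof. by move=> kl; case: ltngtP => // /val_inj lk; rewrite lk eqxx in kl. Qed.

Definition mat (f : word -> word -> F) : mtx :=
  \matrix_(i, j) f (enum_val i) (enum_val j).
Definition entry (M : mtx) (x y : word) : F := M (enum_rank x) (enum_rank y).

Lemma ent_mat f x y : entry (mat f) x y = f x y.
Proof. by rewrite /entry mxE !enum_rankK. Qed.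

Lemma entP M N : (forall x y, entry M x y = entry N x y) -> M = N.
Proof.
move=> MN; apply/matrixP=> i j.
by have:= MN (enum_val i) (enum_val j); rewrite /entry !enum_valK.
Qed.

Lemma ent_mul M N x z : entry (M *m N) x z = \sum_y entry M x y * entry N y z.
Proof. by rewrite /entry mxE (reindex enum_rank) //; apply/onW_bij/enum_rank_bij. Qed.

Lemma entD M N x y : entry (M + N) x y = entry M x y + entry N x y.
Proof. by rewrite /entry mxE. Qed.
Lemma entZ c M x y : entry (c *: M) x y = c * entry M x y.
Proof. by rewrite /entry mxE. Qed.
Lemma ent0 x y : entry 0 x y = 0.
Proof. by rewrite /entry mxE. Qed.
Lemma ent_sum (J : Type) (r : seq J) (P : pred J) (M : J -> mtx) x y :
  entry (\sum_(i <- r | P i) M i) x y = \sum_(i <- r | P i) entry (M i) x y.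
Proof. by rewrite /entry summxE. Qed.

(** Slot operators, super permutations and J factors all send a basis word to a multiple of a basis
    word. Identities between them thus split into a comparison of words and a comparison of
    signs. *)
Definition monomial (c : word -> F) (f : word -> word) : mtx :=
  mat (fun x y => c y * (x == f y)%:R).

Lemma ent_mono c f x y : entry (monomial c f) x y = c y * (x == f y)%:R.
Proof. exact: ent_mat. Qed.

Lemma mono_ext c f c' f' : (forall y, c y = c' y) ->
  (forall y, c y != 0 -> f y = f' y) -> monomial c f = monomial c' f'.
Proof.
move=> cc ff; apply: entP => x y; rewrite !ent_mono -cc.
by have [->|/ff ->] := eqVneq (c y) 0; rewrite ?mul0r.
Qed.

Lemma ent_Mmono M c f x z : entry (M *m monomial c f) x z = entry M x (f z) * c z.
Proof.
rewrite ent_mul (bigD1 (f z)) //= ent_mono eqxx mulr1 big1 ?addr0 // => y nyz.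
by rewrite ent_mono (negbTE nyz) !mulr0.
Qed.

Lemma mono_mul c f c' f' :
  monomial c f *m monomial c' f' = monomial (fun y => c' y * c (f' y)) (f \o f').
Proof. by apply: entP => x z; rewrite ent_Mmono !ent_mono mulrC mulrA. Qed.

Lemma mono_scale a c f : a *: monomial c f = monomial (fun y => a * c y) f.
Proof. by apply: entP => x z; rewrite entZ !ent_mono mulrA. Qed.

Lemma mono1 : monomial (fun=> 1) id = 1%:M.
Proof.
apply: entP => x y; rewrite ent_mono mul1r /entry mxE.
by rewrite (inj_eq enum_rank_inj).
Qed.

Definition diag (c : word -> F) : mtx := monomial c id.

Lemma ent_dgM c M x y : entry (diag c *m M) x y = c x * entry M x y.
Proof.
rewrite ent_mul (bigD1 x) //= ent_mono eqxx mulr1 big1 ?addr0 // => z nzx.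
by rewrite ent_mono eq_sym (negbTE nzx) mulr0 mul0r.
Qed.

Lemma ent_Mdg c M x y : entry (M *m diag c) x y = entry M x y * c y.
Proof. by rewrite ent_Mmono. Qed.

Lemma dg_mul c c' : diag c *m diag c' = diag (fun y => c y * c' y).
Proof. by rewrite /diag mono_mul; apply: mono_ext => // y; rewrite mulrC. Qed.

Definition upd (y : word) (k : 'I_d) (i : T) : word :=
  [ffun m => if m == k then i else y m].

Lemma updE y k i m : upd y k i m = if m == k then i else y m.
Proof. by rewrite ffunE. Qed.

Lemma upd_upd y k i j : upd (upd y k i) k j = upd y k j.
Proof. by apply/ffunP=> m; rewrite !updE; case: eqP. Qed.

Lemma upd_swap y k l i j : k != l -> upd (upd y k i) l j = upd (upd y l j) k i.
Proof.
move=> kl; apply/ffunP=> m; rewrite !updE.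
by have [->|//] := eqVneq m l; rewrite eq_sym (negbTE kl).
Qed.

(** The bound is a natural number rather than a slot, so that [pre_parity d] is the parity of the
    whole word. *)
Definition pre_parity (k : nat) (y : word) : bool := \big[addb/false]_(m < d | (m < k)%N) par (y m).

Lemma pre_parity_upd k y l i :
  pre_parity k (upd y l i) = pre_parity k y (+) ((l < k)%N && (par i (+) par (y l))).
Proof.
rewrite /pre_parity; case: (boolP (l < k)%N) => lk /=; last first.
  rewrite addbF; apply: eq_bigr => m mk; rewrite updE; case: eqP => // ml.
  by rewrite -ml mk in lk.
rewrite (bigD1 l) // [in RHS](bigD1 l) //= updE eqxx.
set s1 := \big[_/_]_(_ | _) _; set s2 := \big[_/_]_(_ | _) _.
have -> : s1 = s2 by apply: eq_bigr => m /andP[_ /negbTE ml]; rewrite updE ml.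
by case: (par i); case: (par (y l)); case: s2.
Qed.

(* E_a in slot k: by the Koszul rule an odd E_a picks up the parity of the slots
   before k. *)
Definition unit_op (k : 'I_d) (a : Gn) : mtx :=
  monomial (fun y => (y k == a.2)%:R * sg (gp a && pre_parity k y)) (fun y => upd y k a.1).
Local Notation E := unit_op.

Lemma E_same k a b : E k a *m E k b = (a.2 == b.1)%:R *: E k (a.1, b.2).
Proof.
rewrite /E mono_mul mono_scale; apply: mono_ext => y /=; last by rewrite upd_upd.
rewrite updE eqxx pre_parity_upd ltnn addbF /gp /= eq_sym.
have [->|_] := eqVneq a.2 b.1; last by rewrite mul0r mulr0 mul0r.
rewrite !mul1r -mulrA; congr (_ * _); rewrite -sgD.
by congr sg; case: (par a.1); case: (par b.1); case: (par b.2); case: (pre_parity k y).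
Qed.

(** Of the two slots only the later one sees, through its prefix, the parity change made in the
    earlier one; this is the Koszul sign. *)
Lemma E_comm k l a b : k != l ->
  E k a *m E l b = sg (gp a && gp b) *: (E l b *m E k a).
Proof.
move=> kl; rewrite /E !mono_mul mono_scale.
apply: mono_ext => y /=; last by rewrite upd_swap // eq_sym.
rewrite !pre_parity_upd !updE (negbTE kl) [l == k]eq_sym (negbTE kl).
have [yk|_] := eqVneq (y k) a.2; last by rewrite !mul0r !mulr0.
have [yl|_] := eqVneq (y l) b.2; last by rewrite !mul0r !mulr0.
rewrite !mul1r -!sgD; congr sg; rewrite /gp yk yl.
rewrite (ltn_ordC kl).
by case: (k < l)%N; case: (par a.1); case: (par a.2); case: (par b.1);
  case: (par b.2); case: (pre_parity k y); case: (pre_parity l y).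
Qed.

(** The Koszul sign of a permutation: only inversions between two odd letters count. *)
Definition inv_parity (s : 'S_d) (y : word) : bool :=
  \big[addb/false]_(k < d) \big[addb/false]_(l < d)
    ((k < l)%N && (s l < s k)%N && (par (y (s k)) && par (y (s l)))).

Definition precomp (s : 'S_d) (y : word) : word := [ffun k => y (s k)].

Definition perm_op (s : 'S_d) : mtx := monomial (fun y => sg (inv_parity s y)) (precomp s).
Local Notation rp := perm_op.

(** Both sides sum a symmetric function over unordered pairs; [s] only decides which ordering
    represents a pair. *)
Lemma xor_sum_swap (s : 'S_d) (G : 'I_d -> 'I_d -> bool) :
  (forall k l, G k l = G l k) ->
  \big[addb/false]_(k < d) \big[addb/false]_(l < d) ((s k < s l)%N && G k l) =
  \big[addb/false]_(k < d) \big[addb/false]_(l < d) ((k < l)%N && G k l).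
Proof.
move=> Gsym.
transitivity (\big[addb/false]_(k < d) \big[addb/false]_(l < d)
   (((k < l)%N && (s k < s l)%N && G k l) (+) ((l < k)%N && (s k < s l)%N && G k l))).
  apply: eq_bigr => k _; apply: eq_bigr => l _.
  have [->|kl] := eqVneq k l; first by rewrite !ltnn.
  by rewrite (ltn_ordC kl); case: (k < l)%N; rewrite /= ?addbF.
under eq_bigr do rewrite big_split; rewrite big_split /= [X in _ (+) X]exchange_big -big_split.
apply: eq_bigr => k _; rewrite -big_split; apply: eq_bigr => l _ /=.
have [->|kl] := eqVneq k l; first by rewrite !ltnn.
have skl : s k != s l by rewrite (inj_eq perm_inj).
by rewrite (Gsym l k) (ltn_ordC skl); case: (k < l)%N; case: (s k < s l)%N; case: (G k l).
Qed.

Lemma rpM s t : rp (s * t)%g = rp s *m rp t.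
Proof.
rewrite /rp mono_mul; apply: mono_ext => y; last first.
  by move=> _; apply/ffunP=> k; rewrite !ffunE permM.
rewrite -sgD; congr sg; rewrite /inv_parity.
pose FF k l := par (y (t (s k))) && par (y (t (s l))).
(* [H] marks the odd pairs whose order is changed by [t] after [s]. Over pairs with [s k < s l]
   these are the inversions of [t]; over pairs with [k < l] they are the discrepancy between the
   inversions of [s] and of [s * t]. *)
pose H k l := ((s k < s l)%N (+) (t (s k) < t (s l))%N) && FF k l.
have -> : \big[addb/false]_(k < d) \big[addb/false]_(l < d)
    ((k < l)%N && (t l < t k)%N && (par (y (t k)) && par (y (t l)))) =
    \big[addb/false]_(k < d) \big[addb/false]_(l < d) ((s k < s l)%N && H k l).
  rewrite (reindex_inj (@perm_inj _ s)); apply: eq_bigr => k _.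
  rewrite (reindex_inj (@perm_inj _ s)); apply: eq_bigr => l _; rewrite /H /FF.
  have [->|kl] := eqVneq k l; first by rewrite !ltnn.
  have tskl : t (s k) != t (s l) by rewrite !(inj_eq perm_inj).
  by rewrite (ltn_ordC tskl); case: (s k < s l)%N; case: (t _ < t _)%N.
rewrite xor_sum_swap; last first.
  move=> k l; rewrite /H /FF andbC [in RHS]andbC [in LHS](andbC (par _)).
  have [->//|kl] := eqVneq k l.
  have skl : s k != s l by rewrite (inj_eq perm_inj).
  have tskl : t (s k) != t (s l) by rewrite !(inj_eq perm_inj).
  by rewrite (ltn_ordC tskl) (ltn_ordC skl); case: (s k < s l)%N; case: (t _ < t _)%N.
rewrite -big_split; apply: eq_bigr => k _; rewrite -big_split; apply: eq_bigr => l _ /=.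
rewrite /H /FF !ffunE !permM.
have [->|kl] := eqVneq k l; first by rewrite !ltnn.
have skl : s k != s l by rewrite (inj_eq perm_inj).
have tskl : t (s k) != t (s l) by rewrite !(inj_eq perm_inj).
rewrite (ltn_ordC tskl) (ltn_ordC skl); set b := _ && par _.
by case: (k < l)%N; case: (s k < s l)%N; case: (t _ < t _)%N; case: b.
Qed.

Lemma rp1 : rp 1%g = 1%:M.
Proof.
rewrite /rp -mono1; apply: mono_ext => y; last by move=> _; apply/ffunP=> k; rewrite ffunE perm1.
rewrite /inv_parity big1 // => k _; rewrite big1 // => l _; rewrite !perm1.
by case: ltngtP.
Qed.

(** Only pairs containing position [k] change. They involve the slots whose order relative to [k] is
    reversed by [s], the symmetric difference of the two prefixes on the right. *)
Lemma inv_parity_upd s y k i :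
  inv_parity s (upd y (s k) i) = inv_parity s y (+)
   ((par i (+) par (y (s k))) && (pre_parity (s k) y (+) pre_parity k (precomp s y))).
Proof.
set c := par i (+) _.
have parE l : par (upd y (s k) i (s l)) = par (y (s l)) (+) (c && (l == k)).
  rewrite updE (inj_eq perm_inj); have [->|_] := eqVneq l k; last by rewrite andbF addbF.
  by rewrite andbT /c addbC -addbA addbb addbF.
transitivity (inv_parity s y (+) (c && (\big[addb/false]_(l < d) ((k < l)%N && (s l < s k)%N && par (y (s l)))
   (+) \big[addb/false]_(m < d) ((m < k)%N && (s k < s m)%N && par (y (s m)))))).
  rewrite /inv_parity.
  transitivity (\big[addb/false]_(m < d) \big[addb/false]_(l < d)
    (((m < l)%N && (s l < s m)%N && (par (y (s m)) && par (y (s l)))) (+)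
     (((m == k) && (c && ((k < l)%N && (s l < s k)%N && par (y (s l))))) (+)
     ((l == k) && (c && ((m < k)%N && (s k < s m)%N && par (y (s m)))))))).
    apply: eq_bigr => m _; apply: eq_bigr => l _; rewrite !parE {parE}.
    have [->|mk] := eqVneq m k; have [->|lk] := eqVneq l k; rewrite ?ltnn ?andbF //=;
    rewrite ?andbT ?andbF ?addbF;
    by case: c; case: (_ < _)%N; case: (_ < _)%N; case: (par _); case: (par _).
  under eq_bigr do rewrite big_split big_split /=.
  rewrite big_split big_split /=; congr (_ (+) _); rewrite andb_addr; congr (_ (+) _).
    rewrite (bigD1 k) //= eqxx [X in _ (+) X]big1 => [|m /negbTE mk]; last by rewrite big1 // => l _; rewrite mk.
    by rewrite addbF big_distrr.
  rewrite big_distrr; apply: eq_bigr => m _.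
  by rewrite (bigD1 k) //= eqxx [X in _ (+) X]big1 ?addbF // => l /negbTE ->.
congr (_ (+) (_ && _)).
rewrite /pre_parity [\big[_/_]_(m < d | (m < s k)%N) _]big_mkcond [\big[_/_]_(m < d | (m < k)%N) _]big_mkcond.
rewrite [in RHS](reindex_inj (@perm_inj _ s)) -!big_split; apply: eq_bigr => m _ /=.
rewrite ffunE; have [->|mk] := eqVneq m k; first by rewrite !ltnn.
have smk : s m != s k by rewrite (inj_eq perm_inj).
rewrite (ltn_ordC mk) (ltn_ordC smk).
by case: (m < k)%N; case: (s m < s k)%N; case: (par _).
Qed.

(** The change in the inversion sign compensates the two Koszul prefixes exactly, so no sign is
    left. *)
Lemma rp_E s k a : rp s *m E (s k) a = E k a *m rp s.
Proof.
rewrite /rp /E !mono_mul; apply: mono_ext => y /=; last first.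
  move=> _; apply/ffunP=> m; rewrite !ffunE (inj_eq perm_inj).
  by case: eqP.
rewrite ffunE inv_parity_upd; have [yk|_] := eqVneq (y (s k)) a.2; last by rewrite !mul0r mulr0.
rewrite !mul1r -!sgD /gp -yk; congr sg.
by case: (par a.1); case: (par (y _)); case: (inv_parity _ _); case: (pre_parity k _); case: (pre_parity (s k) y).
Qed.

End SuperTensors.

(** * The double commutant *)

Section DoubleCommutant.
Variables (F : fieldType) (n : nat) (J : finType) (rho rhoV : J -> 'M[F]_n).
Hypothesis rhoKV : forall g, rho g *m rhoV g = 1%:M.
Hypothesis rho_mul : forall g h, exists k, rho g *m rho h = rho k.
Hypothesis rhoV_mul : forall g h, exists k, rhoV g *m rho h = rho k.
Hypothesis rho_one : exists g, rho g = 1%:M.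
Hypothesis card_neq0 : #|J|%:R != 0 :> F.

(* Averaging a linear projection onto N = span rho over the group gives an
   operator p that commutes with left multiplication by the bicommutant and
   satisfies p = #|J| on N; hence #|J| T = T p(1) = p(T) lies in N. *)
Lemma double_commutant (M : 'M[F]_n) :
  (forall Y, let Z := \sum_g rho g *m Y *m rhoV g in M *m Z = Z *m M) ->
  exists c : J -> F, M = \sum_g c g *: rho g.
Proof.
move=> Mcomm; pose N := <<[seq rho g | g <- enum J]>>%VS.
have rhoN g : rho g \in N by apply/memv_span/map_f; rewrite mem_enum.
have spanN A : A \in N -> exists c : J -> F, A = \sum_g c g *: rho g.
  move=> AN; pose X := [tuple of [seq rho g | g <- enum J]].
  exists (fun g => coord X (enum_rank g) A).
  rewrite {1}(coord_span (X := X) AN) (reindex enum_rank); last exact/onW_bij/enum_rank_bij.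
  apply: eq_bigr => g _; congr (_ *: _).
  by rewrite /= (nth_map g) -?cardE // nth_enum_rank.
have mulN (B A : 'M[F]_n) : (forall g, B *m rho g \in N) -> A \in N -> B *m A \in N.
  move=> BN /spanN[c ->]; rewrite mulmx_sumr; apply: memv_suml => g _.
  by rewrite -scalemxAr memvZ.
have rN g A : A \in N -> rho g *m A \in N.
  by apply: mulN => h; have [k ->] := rho_mul g h.
have rVN g A : A \in N -> rhoV g *m A \in N.
  by apply: mulN => h; have [k ->] := rhoV_mul g h.
pose p0 : 'End('M[F]_n) := projv N.
pose p A := \sum_g rho g *m p0 (rhoV g *m A).
have pN A : A \in N -> p A = #|J|%:R *: A.
  move=> AN; rewrite /p (eq_bigr (fun=> A)) ?sumr_const ?scaler_nat // => g _.
  by rewrite projv_id ?rVN // mulmxA rhoKV mul1mx.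
(* In matrix units the averaged projection becomes a combination of the averages of [delta_mx k i],
   and averages are what the hypothesis lets [M] pass. *)
have p0E A : p0 A = \sum_i \sum_j \sum_k \sum_l
    p0 (delta_mx i j) k l *: (delta_mx k i *m A *m delta_mx j l).
  rewrite {1}[A]matrix_sum_delta linear_sum; apply: eq_bigr => i _.
  rewrite linear_sum; apply: eq_bigr => j _; rewrite linearZ /=.
  rewrite {1}[p0 _]matrix_sum_delta scaler_sumr; apply: eq_bigr => k _.
  rewrite scaler_sumr; apply: eq_bigr => l _; rewrite scalerA mulrC -scalerA.
  congr (_ *: _); apply/matrixP=> u v; rewrite !mxE.
  rewrite (bigD1 j) //= big1 => [|w /negbTE wj]; last by rewrite !mxE wj /= mulr0.
  rewrite !mxE (bigD1 i) //= big1 => [|w /negbTE wi]; last by rewrite !mxE wi andbF mul0r.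
  rewrite !mxE !eqxx !addr0 andbT /=.
  by case: (u == k); case: (v == l); rewrite ?mulr1 ?mulr0 ?mul1r ?mul0r.
have pE A : p A = \sum_i \sum_j \sum_k \sum_l p0 (delta_mx i j) k l *:
    ((\sum_g rho g *m delta_mx k i *m rhoV g) *m A *m delta_mx j l).
  rewrite /p; under eq_bigr => g _ do rewrite p0E mulmx_sumr.
  rewrite exchange_big; apply: eq_bigr => i _.
  under eq_bigr do rewrite mulmx_sumr.
  rewrite exchange_big; apply: eq_bigr => j _.
  under eq_bigr do rewrite mulmx_sumr.
  rewrite exchange_big; apply: eq_bigr => k _.
  under eq_bigr do rewrite mulmx_sumr.
  rewrite exchange_big; apply: eq_bigr => l _.
  rewrite !mulmx_suml scaler_sumr; apply: eq_bigr => g _.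
  by rewrite -scalemxAr !mulmxA.
have MpE : M *m p 1%:M = p M.
  rewrite !pE !mulmx_sumr; apply: eq_bigr => i _.
  rewrite mulmx_sumr; apply: eq_bigr => j _.
  rewrite mulmx_sumr; apply: eq_bigr => k _.
  rewrite mulmx_sumr; apply: eq_bigr => l _.
  rewrite -scalemxAr !mulmxA mulmx1; congr (_ *: (_ *m _)).
  exact: Mcomm.
have oneN : 1%:M \in N by have [g <-] := rho_one.
apply: spanN; have : #|J|%:R *: M \in N.
  rewrite -[M in _ *: M]mulmx1 scalemxAr -pN // MpE.
  by rewrite /p; apply: memv_suml => g _; apply: rN; apply: memv_proj.
by move=> /(memvZ #|J|%:R^-1); rewrite scalerA mulVf // scale1r.
Qed.

End DoubleCommutant.

(** * The commutant of k on a tensor power *)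

Section Commutant.
Variables (F : fieldType) (T : finType) (par jp : T -> bool) (d : nat).
Hypothesis char0 : forall n, (n%:R == 0 :> F) = (n == 0)%N.
Local Notation word := {ffun 'I_d -> T}.
Local Notation Gn := (T * T)%type.
Local Notation mtx := 'M[F]_#|{ffun 'I_d -> T}|.
Local Notation E := (@unit_op F T par d).
Local Notation rp := (@perm_op F T par d).
Local Notation gp := (gen_par par).
Local Notation sg := (bsgn F).
Local Notation slot := ('I_d * Gn)%type.

Definition total_op (a : Gn) : mtx := \sum_k E k a.
Local Notation delta := total_op.
Definition parity_op : mtx := diag (fun y => sg (pre_parity par d y)).
Local Notation parmx := parity_op.

Lemma parmx_sq : parmx *m parmx = 1%:M.
Proof. by rewrite dg_mul -mono1; apply: mono_ext => // y; rewrite sg_sq. Qed.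

Lemma parmx_E k a : parmx *m E k a = sg (gp a) *: (E k a *m parmx).
Proof.
rewrite /parmx /unit_op /diag !mono_mul mono_scale; apply: mono_ext => //= y.
rewrite pre_parity_upd ltn_ord /=; have [yk|_] := eqVneq (y k) a.2; last by rewrite !mul0r !mulr0.
by rewrite !mul1r -!sgD /gp yk; congr sg; case: (par _); case: (par _); case: (pre_parity _ _ _); case: (pre_parity _ _ _).
Qed.

Lemma rp_delta s a : rp s *m delta a = delta a *m rp s.
Proof.
rewrite /delta mulmx_sumr mulmx_suml (reindex_inj (@perm_inj _ s)).
by apply: eq_bigr => k _; rewrite rp_E.
Qed.

Lemma rpV s : rp s *m rp s^-1%g = 1%:M.
Proof. by rewrite -rpM mulgV rp1. Qed.

(** With [jp] describing the eigenspaces of J, this separates the letters of p^+ and p^- from those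
    of k. *)
Definition side_change (a : Gn) := jp a.1 (+) jp a.2.
Local Notation jx := side_change.
Definition side_parity (e : {ffun 'I_d -> bool}) (y : word) : bool :=
  \big[addb/false]_k (e k && ~~ jp (y k)).
(** The operator 2J in the slots chosen by [e] and the identity elsewhere; the factor 2 makes it an
    involution. *)
Definition side_op e : mtx := diag (fun y => sg (side_parity e y)).
Local Notation jm := side_op.

Lemma jm_E e k a : jm e *m E k a = sg (e k && jx a) *: (E k a *m jm e).
Proof.
rewrite /jm /unit_op /diag !mono_mul mono_scale; apply: mono_ext => //= y.
have [yk|_] := eqVneq (y k) a.2; last by rewrite !mul0r !mulr0.
rewrite !mul1r mulrCA -!sgD; congr sg; rewrite /side_parity /jx.
rewrite (bigD1 k) // [in RHS](bigD1 k) //= updE eqxx yk.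
set s1 := \big[_/_]_(_ | _) _; set s2 := \big[_/_]_(_ | _) _.
have -> : s1 = s2 by apply: eq_bigr => m /negbTE mk; rewrite updE mk.
by case: (e k); case: (jp _); case: (jp _); case: (s2); case: (gp a && _).
Qed.

Lemma jm_mul e e' : jm e *m jm e' = jm [ffun k => e k (+) e' k].
Proof.
rewrite dg_mul; apply: mono_ext => // y; rewrite -sgD -big_split; congr sg.
by apply: eq_bigr => k _ /=; rewrite ffunE; case: (e k); case: (e' k); case: (jp _).
Qed.

Lemma jm_sq e : jm e *m jm e = 1%:M.
Proof. by rewrite dg_mul -mono1; apply: mono_ext => // y; rewrite sg_sq. Qed.

Lemma rp_jm s e : rp s *m jm e = jm [ffun k => e (s k)] *m rp s.
Proof.
rewrite /jm /perm_op /diag !mono_mul; apply: mono_ext => //= y; rewrite mulrC; congr (_ * sg _).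
rewrite /side_parity (reindex_inj (@perm_inj _ s)).
by apply: eq_bigr => k _; rewrite !ffunE.
Qed.

Fixpoint slot_prod (u : seq slot) : mtx := if u is x :: v then E x.1 x.2 *m slot_prod v else 1%:M.
Local Notation mp := slot_prod.

Definition slots_par (u : seq slot) : bool := foldr (fun x b => gp x.2 (+) b) false u.
Local Notation wp := slots_par.
Local Notation slots u := [seq x.1 | x <- u].
Local Notation Kslots u := (all (fun x : slot => ~~ jx x.2) u).

Lemma rp_mp s u : rp s *m mp [seq (s x.1, x.2) | x <- u] = mp u *m rp s.
Proof.
elim: u => [|x u IH] /=; first by rewrite mul1mx mulmx1.
by rewrite mulmxA rp_E -!mulmxA IH.
Qed.

Lemma E_mp k a u : k \notin slots u ->
  E k a *m mp u = sg (gp a && wp u) *: (mp u *m E k a).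
Proof.
elim: u => [|x u IH] /=; first by rewrite andbF scale1r mul1mx mulmx1.
rewrite inE negb_or => /andP[kx ku]; rewrite mulmxA E_comm // -scalemxAl -mulmxA IH //.
by rewrite -scalemxAr scalerA mulmxA -sgD -andb_addr.
Qed.

(** Two letters in one slot multiply to a matrix unit or to zero, and letters of k are closed under
    this product. If it vanishes, [c] is 0 and the old list serves as [v]. *)
Lemma E_absorb k a u : k \in slots u -> uniq (slots u) -> ~~ jx a -> Kslots u ->
  exists c v, [/\ E k a *m mp u = c *: mp v, slots v = slots u & Kslots v].
Proof.
elim: u => [//|[l b] u IH] /=; rewrite inE => kin /andP[lu uu] Ka /andP[Kb Ku].
have [kl|kl] := eqVneq k l.
  have EE : E k a *m mp ((l, b) :: u) = (a.2 == b.1)%:R *: mp ((l, (a.1, b.2)) :: u).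
    by rewrite /= mulmxA kl E_same scalemxAl.
  have [ab|ab] := eqVneq a.2 b.1.
    exists 1, ((l, (a.1, b.2)) :: u); split; rewrite ?EE ?ab ?eqxx //=.
    move: Ka Kb; rewrite Ku /jx /= ab.
    by case: (jp a.1); case: (jp b.1); case: (jp b.2).
  by exists 0, ((l, b) :: u); split; rewrite ?EE ?(negbTE ab) ?scale0r //= Kb.
move: kin; rewrite (negbTE kl) /= => kin; have [c [v [cv sv Kv]]] := IH kin uu Ka Ku.
exists (sg (gp a && gp b) * c), ((l, b) :: v); split; rewrite /= ?sv ?Kb //.
by rewrite mulmxA E_comm // -scalemxAl -mulmxA cv -scalemxAr scalerA.
Qed.

Definition symmetrise (Y : mtx) : mtx := \sum_s rp s *m Y *m rp s^-1%g.

Lemma symm_conj t Y : symmetrise (rp t *m Y *m rp t^-1%g) = symmetrise Y.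
Proof.
rewrite /symmetrise [RHS](reindex_inj (mulIg t)); apply: eq_bigr => s _.
by rewrite invMg !rpM !mulmxA.
Qed.

Lemma symmZ c Y : symmetrise (c *: Y) = c *: symmetrise Y.
Proof.
rewrite /symmetrise scaler_sumr; apply: eq_bigr => s _.
by rewrite -scalemxAr -scalemxAl.
Qed.

Lemma symm_sum (J : finType) (P : pred J) (G : J -> mtx) :
  symmetrise (\sum_(i | P i) G i) = \sum_(i | P i) symmetrise (G i).
Proof.
rewrite /symmetrise exchange_big; apply: eq_bigr => s _.
by rewrite mulmx_sumr mulmx_suml.
Qed.

Lemma symm_delta a Y : symmetrise (delta a *m Y) = delta a *m symmetrise Y.
Proof.
rewrite /symmetrise mulmx_sumr; apply: eq_bigr => s _.
by rewrite mulmxA rp_delta !mulmxA.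
Qed.

(** The transposition of [k] and [l] carries one product to the other and leaves the slots of [u]
    alone, and [symmetrise] does not see conjugation. *)
Lemma symm_transfer k l a u : k \notin slots u -> l \notin slots u ->
  symmetrise (E k a *m mp u) = symmetrise (E l a *m mp u).
Proof.
move=> ku lu; pose s := tperm k l.
have fixu : [seq (s x.1, x.2) | x <- u] = u.
  rewrite -[RHS]map_id; apply/eq_in_map => -[m b] /(map_f fst) /= mu.
  rewrite /s tpermD //; first by apply: contraNneq ku => ->.
  by apply: contraNneq lu => ->.
rewrite -(symm_conj s (E k a *m mp u)); congr symmetrise.
have -> : rp s *m (E k a *m mp u) = E l a *m mp u *m rp s.
  have -> : E k a = E (s l) a by rewrite /s tpermR.
  by rewrite mulmxA rp_E -mulmxA -{1}fixu rp_mp mulmxA.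
by rewrite -mulmxA rpV mulmx1.
Qed.

Section Centraliser.
Variable M : mtx.
Hypothesis M_delta : forall a, ~~ jx a -> M *m delta a = delta a *m M.
Let commutesM (Y : mtx) := M *m Y = Y *m M.

Lemma cmZ c Y : commutesM Y -> commutesM (c *: Y).
Proof. by rewrite /commutesM -scalemxAr -scalemxAl => ->. Qed.

Lemma cmB Y Z : commutesM Y -> commutesM Z -> commutesM (Y - Z).
Proof. by rewrite /commutesM mulmxBr mulmxBl => -> ->. Qed.

Lemma cm_sum (J : finType) (P : pred J) (G : J -> mtx) :
  (forall i, P i -> commutesM (G i)) -> commutesM (\sum_(i | P i) G i).
Proof.
by move=> cG; rewrite /commutesM mulmx_sumr mulmx_suml; apply: eq_bigr => i /cG.
Qed.

(** Symmetrised products of letters of k are polynomials in the total operators, just as symmetric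
    functions are polynomials in power sums: in [delta a *m symmetrise (mp u)] the free slots give
    equal terms, the occupied ones give products with fewer letters. *)
Lemma cm_symm_mp u : uniq (slots u) -> Kslots u -> commutesM (symmetrise (mp u)).
Proof.
have [m] := ubnP (size u); elim: m u => // m IH [|[l a] u] /=.
  move=> _ _ _; rewrite /symmetrise; apply: cm_sum => s _.
  by rewrite mulmx1 rpV /commutesM mulmx1 mul1mx.
rewrite ltnS => um /andP[lu uu] /andP[Ka Ku].
(* The number of free slots; [l] is one of them, so it is invertible. *)
pose Nl := #|[pred k | k \notin slots u]|.
have Nl0 : Nl%:R != 0 :> F.
  by rewrite char0 -lt0n; apply/card_gt0P; exists l.
have defu : symmetrise (E l a *m mp u) = Nl%:R^-1 *: (delta a *m symmetrise (mp u) -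
    \sum_(k | k \in slots u) symmetrise (E k a *m mp u)).
  rewrite -symm_delta /delta mulmx_suml symm_sum (bigID (mem (slots u))) /=.
  rewrite addrC addrK (eq_bigr (fun=> symmetrise (E l a *m mp u))) => [|k ku]; last exact: symm_transfer.
  by rewrite sumr_const -scaler_nat scalerA mulVf ?scale1r.
rewrite defu; apply/cmZ/cmB.
  by rewrite /commutesM mulmxA M_delta // -!mulmxA IH.
apply: cm_sum => k ku; have [c [v [-> sv Kv]]] := E_absorb ku uu Ka Ku.
rewrite symmZ; apply/cmZ/IH; rewrite ?sv //.
by rewrite -(size_map fst) sv size_map.
Qed.

Local Notation grp := ({ffun 'I_d -> bool} * 'S_d)%type.
(** The pairs index the wreath product of Z/2 with S_d. Only the operators are multiplied, so no
    group law on pairs is introduced. *)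
Definition grp_op (g : grp) : mtx := jm g.1 *m rp g.2.
Local Notation rho := grp_op.
Definition rhoV (g : grp) : mtx := rp g.2^-1%g *m jm g.1.

Definition word_unit (x y : word) : mtx := monomial (fun z => (z == y)%:R) (fun=> x).

Definition upd_slots (u : seq slot) (y : word) : word := foldr (fun x z => upd z x.1 x.2.1) y u.

Lemma upds_out u y k : k \notin slots u -> upd_slots u y k = y k.
Proof.
elim: u => [//|x u IH] /=; rewrite inE negb_or => /andP[kx ku].
by rewrite updE (negbTE kx) IH.
Qed.

Lemma mp_mono u : uniq (slots u) -> exists e : word -> bool,
  mp u = monomial (fun y => (all (fun x : slot => y x.1 == x.2.2) u)%:R * sg (e y)) (upd_slots u).
Proof.
elim: u => [_|x u IH] /=.
  by exists (fun=> false); rewrite -mono1; apply: mono_ext => // y; rewrite mul1r.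
move=> /andP[xu uu]; have [e ->] := IH uu.
exists (fun y => e y (+) (gp x.2 && pre_parity par x.1 (upd_slots u y))).
rewrite /unit_op mono_mul; apply: mono_ext => //= y; rewrite upds_out // sgD.
by case: (_ == _); case: all; rewrite /= ?mul1r ?mul0r ?mulr0.
Qed.

(** Each slot occurs once, in increasing order. Up to sign the product of these letters is a matrix
    unit, so such products form a basis of all operators, each carrying a word of length [d]. *)
Definition graph (x y : word) : seq slot := [seq (k, (x k, y k)) | k <- enum 'I_d].

Lemma slots_graph x y : slots (graph x y) = enum 'I_d.
Proof. by rewrite -map_comp map_id. Qed.

Lemma mp_graph x y : exists e : bool, mp (graph x y) = sg e *: word_unit x y.
Proof.
have [|e ->] := @mp_mono (graph x y); first by rewrite slots_graph enum_uniq.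
exists (e y); rewrite /word_unit mono_scale; apply: mono_ext => z /=.
  have -> : all (fun u : slot => z u.1 == u.2.2) (graph x y) = (z == y).
    apply/allP/eqP => [zy|-> u /mapP[k _ ->] //]; apply/ffunP=> k.
    have /zy/eqP := map_f (fun k => (k, (x k, y k))) (mem_enum 'I_d k).
    by apply.
  by have [->|_] := eqVneq z y; rewrite ?mul0r ?mulr0 // mul1r mulr1.
move=> _; apply/ffunP=> k.
suff : forall r : seq 'I_d, k \in r -> upd_slots [seq (k, (x k, y k)) | k <- r] z k = x k.
  by apply; rewrite mem_enum.
elim=> //= l r IH; rewrite inE updE; case: eqP => [-> //|_]; exact: IH.
Qed.

Lemma mtx_dmx (Y : mtx) : Y = \sum_x \sum_y entry Y x y *: word_unit x y.
Proof.
apply: entP => x y; rewrite ent_sum (bigD1 x) //= [X in _ + X]big1 ?addr0; last first.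
  move=> z zx; rewrite ent_sum big1 // => t _; rewrite entZ ent_mono.
  by rewrite [x == z]eq_sym (negbTE zx) !mulr0.
rewrite ent_sum (bigD1 y) //= [X in _ + X]big1 ?addr0; last first.
  by move=> z zy; rewrite entZ ent_mono [y == z]eq_sym (negbTE zy) mul0r mulr0.
by rewrite entZ ent_mono !eqxx !mulr1.
Qed.

Fixpoint weight_parity (e : 'I_d -> bool) (u : seq slot) : bool :=
  if u is x :: v then (e x.1 && jx x.2) (+) weight_parity e v else false.

Lemma jm_mp e u : jm e *m mp u = sg (weight_parity e u) *: (mp u *m jm e).
Proof.
elim: u => [|x u IH] /=; first by rewrite scale1r mul1mx mulmx1.
by rewrite mulmxA jm_E -scalemxAl -mulmxA IH -scalemxAr scalerA -sgD mulmxA.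
Qed.

Lemma jw_K e u : Kslots u -> weight_parity e u = false.
Proof. by elim: u => //= x u IH /andP[/negbTE -> /IH ->]; rewrite andbF. Qed.

(** Toggling [e] in a slot that holds a side-changing letter flips the sign, so the sum is its own
    negative. *)
Lemma sum_sg_jw u : uniq (slots u) -> ~~ Kslots u ->
  \sum_(e : {ffun 'I_d -> bool}) sg (weight_parity e u) = 0.
Proof.
move=> uu; rewrite -has_predC => /hasP[[k a] uk /negPn /= ja].
have jw0 v : k \notin slots v -> weight_parity (pred1 k) v = false.
  elim: v => //= x v IH; rewrite inE negb_or eq_sym => /andP[/negbTE kx kv].
  by rewrite kx IH.
have jwk : weight_parity (pred1 k) u = true.
  elim: u uu uk => //= x u IH /andP[xu uu]; rewrite inE => /orP[/eqP xE|uk].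
    by rewrite -xE /= eqxx ja /= jw0 // -[k]/(k, a).1 xE.
  rewrite IH //; case: eqP => //= xk; move: xu; rewrite xk.
  by have /= -> := map_f fst uk.
pose tog (e : {ffun 'I_d -> bool}) := [ffun m => e m (+) (m == k)].
have jwtog e : weight_parity (tog e) u = ~~ weight_parity e u.
  rewrite -addbT -[in RHS]jwk; elim: u {uu uk jwk} => //= x u ->.
  by rewrite ffunE; case: (e x.1); case: (x.1 == k); case: (jx _); case: (weight_parity e u); case: (weight_parity _ u).
have togK : involutive tog.
  by move=> e; apply/ffunP=> m; rewrite !ffunE -addbA addbb addbF.
set S := \sum_e _; have SN : S = - S.
  rewrite {1}/S (reindex_inj (inv_inj togK)) -sumrN; apply: eq_bigr => e _.
  by rewrite jwtog; case: (weight_parity e u); rewrite ?opprK.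
have : S * 2%:R = 0 by rewrite mulr_natr mulr2n {1}SN addNr.
by move/eqP; rewrite mulf_eq0 char0 orbF => /eqP.
Qed.

Definition average (Y : mtx) : mtx := \sum_g rho g *m Y *m rhoV g.

Lemma avgZ c Y : average (c *: Y) = c *: average Y.
Proof.
rewrite /average scaler_sumr; apply: eq_bigr => s _.
by rewrite -scalemxAr -scalemxAl.
Qed.

Lemma avg_sum (J : finType) (P : pred J) (G : J -> mtx) :
  average (\sum_(i | P i) G i) = \sum_(i | P i) average (G i).
Proof.
rewrite /average exchange_big; apply: eq_bigr => s _.
by rewrite mulmx_sumr mulmx_suml.
Qed.

(** The sum over the J factors kills a product with a side-changing letter and multiplies any other
    one by a constant; what remains is the sum over permutations, treated by [cm_symm_mp]. *)
Lemma cm_avg_mp u : uniq (slots u) -> commutesM (average (mp u)).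
Proof.
move=> uu; have termE (g : grp) : rho g *m mp u *m rhoV g =
    sg (weight_parity g.1 [seq (g.2^-1%g x.1, x.2) | x <- u]) *: (rp g.2 *m mp u *m rp g.2^-1%g).
  case: g => e s; rewrite /rho /rhoV; set u' := [seq (s^-1%g _, _) | x <- u].
  have us : [seq (s x.1, x.2) | x <- u'] = u.
    by rewrite -map_comp -[RHS]map_id; apply: eq_map => -[k a] /=; rewrite permKV.
  have -> : rp s *m mp u *m rp s^-1%g = mp u'.
    by rewrite -{1}us rp_mp -mulmxA rpV mulmx1.
  rewrite !mulmxA -(mulmxA (jm e)) -{1}us rp_mp.
  by rewrite !mulmxA jm_mp -(mulmxA _ (rp s)) rpV mulmx1 -scalemxAl -mulmxA jm_sq mulmx1.
have -> : average (mp u) = \sum_(s : 'S_d) (\sum_(e : {ffun 'I_d -> bool})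
    sg (weight_parity e [seq (s^-1%g x.1, x.2) | x <- u])) *: (rp s *m mp u *m rp s^-1%g).
  rewrite /average (eq_bigr _ (fun g _ => termE g)).
  rewrite -(pair_bigA _ (fun (e : {ffun 'I_d -> bool}) (s : 'S_d) => sg (weight_parity e [seq (s^-1%g x.1, x.2) | x <- u])
     *: (rp s *m mp u *m rp s^-1%g))) exchange_big /=.
  by apply: eq_bigr => s _; rewrite scaler_suml.
have [Ku|nKu] := boolP (Kslots u).
  have -> : \sum_(s : 'S_d) (\sum_(e : {ffun 'I_d -> bool})
      sg (weight_parity e [seq (s^-1%g x.1, x.2) | x <- u])) *: (rp s *m mp u *m rp s^-1%g) =
      #|{ffun 'I_d -> bool}|%:R *: symmetrise (mp u).
    rewrite /symmetrise scaler_sumr; apply: eq_bigr => s _; congr (_ *: _).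
    rewrite -sumr_const; apply: eq_bigr => e _; rewrite jw_K // all_map.
    exact: Ku.
  exact/cmZ/cm_symm_mp.
rewrite big1 => [|s _]; first by rewrite /commutesM mulmx0 mul0mx.
rewrite sum_sg_jw ?scale0r ?all_map // -map_comp.
have -> : [seq (fst \o (fun x : slot => (s^-1%g x.1, x.2))) x | x <- u] =
          [seq s^-1%g k | k <- slots u] by rewrite -map_comp.
by rewrite map_inj_uniq //; apply: perm_inj.
Qed.

Lemma cm_avg Y : commutesM (average Y).
Proof.
rewrite [Y]mtx_dmx avg_sum; apply: cm_sum => x _.
rewrite avg_sum; apply: cm_sum => y _; rewrite avgZ; apply: cmZ.
have [e mpE] := mp_graph x y.
have -> : word_unit x y = sg e *: mp (graph x y) by rewrite mpE scalerA sg_sq scale1r.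
by rewrite avgZ; apply/cmZ/cm_avg_mp; rewrite slots_graph enum_uniq.
Qed.

Lemma commutant_span : exists c : grp -> F, M = \sum_g c g *: rho g.
Proof.
apply: (@double_commutant _ _ _ rho rhoV) => [[e s]|[e s] [e' t]|[e s] [e' t]|||Y].
- by rewrite /rho /rhoV mulmxA -(mulmxA (jm e)) rpV mulmx1 jm_sq.
- exists ([ffun k => e k (+) [ffun k => e' (s k)] k], (s * t)%g).
  by rewrite /rho /= rpM mulmxA -(mulmxA (jm e)) rp_jm mulmxA jm_mul -!mulmxA.
- exists ([ffun k => [ffun k => e k (+) e' k] (s^-1%g k)], (s^-1 * t)%g).
  by rewrite /rho /rhoV /= rpM mulmxA -(mulmxA _ (jm e)) jm_mul rp_jm -!mulmxA.
- exists ([ffun=> false], 1%g); rewrite /rho /= rp1 mulmx1 /jm -mono1.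
  by apply: mono_ext => // y; rewrite /side_parity big1 // => k _; rewrite ffunE.
- by rewrite char0 -lt0n; apply/card_gt0P; exists ([ffun=> false], 1%g).
- exact: cm_avg.
Qed.

End Centraliser.
End Commutant.

Lemma bracket_cancel (V : zmodType) (x1 x2 x3 x4 x5 x6 : V) :
  x1 - x2 - (x3 - x4) - ((x5 - x3) - (x2 - x6)) = x1 - x5 - (x6 - x4).
Proof.
rewrite (opprB (x5 - x3)) addrACA; have -> : x1 - x2 + (x2 - x6) = x1 - x6 by rewrite addrA subrK.
have -> : - (x3 - x4) - (x5 - x3) = - (x5 - x4).
  by rewrite -opprD [in LHS]addrC addrA subrK.
by rewrite !opprB ![x4 - _]addrC !addrA (addrAC x1 (- x6)).
Qed.

(** * The adjoint action on operators *)

Section Adjoint.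
Variables (F : fieldType) (T : finType) (par : T -> bool) (d : nat).
Local Notation Gn := (T * T)%type.
Local Notation mtx := 'M[F]_#|{ffun 'I_d -> T}|.
Local Notation E := (@unit_op F T par d).
Local Notation gp := (gen_par par).
Local Notation sg := (bsgn F).
Local Notation delta := (@total_op F T par d).
Local Notation parmx := (@parity_op F T par d).
Local Notation mp := (@slot_prod F T par d).
Local Notation wp := (@slots_par T par d).

(** Conjugation by the parity operator supplies the Koszul sign, so that the super bracket is
    defined on inhomogeneous operators too. *)
Definition parity_conj (b : bool) (Y : mtx) : mtx := if b then parmx *m Y *m parmx else Y.
Local Notation sgm := parity_conj.
Definition sad (a : Gn) (Y : mtx) : mtx := delta a *m Y - sgm (gp a) Y *m delta a.
Local Notation ad := sad.

Lemma sgmD b Y Z : sgm b (Y + Z) = sgm b Y + sgm b Z.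
Proof. by case: b; rewrite /sgm ?mulmxDr ?mulmxDl. Qed.

Lemma sgmZ b c Y : sgm b (c *: Y) = c *: sgm b Y.
Proof. by case: b; rewrite /sgm -?scalemxAr -?scalemxAl. Qed.

Lemma sgmB b Y Z : sgm b (Y - Z) = sgm b Y - sgm b Z.
Proof. by rewrite sgmD -scaleN1r sgmZ scaleN1r. Qed.

Lemma sgmM b Y Z : sgm b (Y *m Z) = sgm b Y *m sgm b Z.
Proof.
by case: b => //; rewrite /sgm !mulmxA -(mulmxA (parmx *m Y) parmx) parmx_sq mulmx1.
Qed.

Lemma sgm_sgm b c Y : sgm b (sgm c Y) = sgm (b (+) c) Y.
Proof.
case: b; case: c => //; rewrite /sgm /= !mulmxA parmx_sq mul1mx.
by rewrite -mulmxA parmx_sq mulmx1.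
Qed.

Lemma sgm_E b k a : sgm b (E k a) = sg (b && gp a) *: E k a.
Proof.
case: b; rewrite /sgm ?scale1r // parmx_E -scalemxAl -mulmxA parmx_sq mulmx1.
by [].
Qed.

Lemma sgm_delta b a : sgm b (delta a) = sg (b && gp a) *: delta a.
Proof.
rewrite /total_op scaler_sumr -(eq_bigr _ (fun k _ => sgm_E b k a)).
by case: b; rewrite /sgm // mulmx_sumr mulmx_suml.
Qed.

Lemma sgm_mp b u : sgm b (mp u) = sg (b && wp u) *: mp u.
Proof.
elim: u => [|x u IH] /=.
  by rewrite andbF scale1r; case: b; rewrite /sgm // mulmx1 parmx_sq.
by rewrite sgmM sgm_E IH -scalemxAl -scalemxAr scalerA -sgD andb_addr.
Qed.

Lemma adD a Y Z : ad a (Y + Z) = ad a Y + ad a Z.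
Proof. by rewrite /ad sgmD mulmxDr mulmxDl opprD addrACA. Qed.

Lemma adZ a c Y : ad a (c *: Y) = c *: ad a Y.
Proof. by rewrite /ad sgmZ -scalemxAr -scalemxAl scalerBr. Qed.

Lemma ad_sum a (J : Type) (r : seq J) (P : pred J) (G : J -> mtx) :
  ad a (\sum_(i <- r | P i) G i) = \sum_(i <- r | P i) ad a (G i).
Proof.
apply: (big_morph (ad a) (adD a)).
by have := adZ a 0 0; rewrite !scale0r.
Qed.

Lemma E_br k a b :
  delta a *m E k b - sg (gp a && gp b) *: (E k b *m delta a) =
  (a.2 == b.1)%:R *: E k (a.1, b.2)
  - (sg (gp a && gp b) * (b.2 == a.1)%:R) *: E k (b.1, a.2).
Proof.
rewrite /total_op mulmx_suml mulmx_sumr scaler_sumr -sumrB (bigD1 k) //=.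
rewrite big1 ?addr0 => [|l lk]; last by rewrite E_comm // subrr.
by rewrite !E_same scalerA.
Qed.

Lemma delta_br a b :
  delta a *m delta b - sg (gp a && gp b) *: (delta b *m delta a) =
  (a.2 == b.1)%:R *: delta (a.1, b.2)
  - (sg (gp a && gp b) * (b.2 == a.1)%:R) *: delta (b.1, a.2).
Proof.
rewrite {2 3}/total_op mulmx_sumr mulmx_suml scaler_sumr -sumrB.
by rewrite (eq_bigr _ (fun k _ => E_br k a b)) sumrB -!scaler_sumr.
Qed.

Lemma ad_br a b Y :
  ad a (ad b Y) - sg (gp a && gp b) *: ad b (ad a Y) =
  (a.2 == b.1)%:R *: ad (a.1, b.2) Y
  - (sg (gp a && gp b) * (b.2 == a.1)%:R) *: ad (b.1, a.2) Y.
Proof.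
set e := sg _.
pose B := delta a *m delta b - e *: (delta b *m delta a).
have ee : e * e = 1 by rewrite sg_sq.
(* The unit [(a.1, b.2)] is sure to have parity [gp a (+) gp b] only when [a.2 == b.1]; otherwise
   its coefficient is zero and any twist [g] will do. *)
have adE c (g : bool) (k : F) : g = gp c \/ k = 0 ->
    k *: ad c Y = (k *: delta c) *m Y - sgm g Y *m (k *: delta c).
  case=> [->|->]; last by rewrite !scale0r mul0mx mulmx0 subrr.
  by rewrite /ad -scalemxAl -scalemxAr scalerBr.
have -> : ad a (ad b Y) - e *: ad b (ad a Y) = B *m Y - sgm (gp a (+) gp b) Y *m B.
  rewrite /ad !sgmB !sgmM !sgm_delta !sgm_sgm [gp b && gp a]andbC -/e /B.
  rewrite [gp b (+) gp a]addbC !mulmxBr !mulmxBl -!scalemxAl -!scalemxAr -!scalemxAl !scalerBr !scalerA.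
  by rewrite ee !scale1r !mulmxA bracket_cancel.
rewrite (adE (a.1, b.2) (gp a (+) gp b)); last first.
  by case: eqP => [ab|_]; [left; rewrite /gen_par /= ab; case: (par _); case: (par _); case: (par _) | right].
rewrite (adE (b.1, a.2) (gp a (+) gp b)); last first.
  case: eqP => [ab|_]; [left|right; rewrite mulr0 //].
  by rewrite /gen_par /= ab; case: (par _); case: (par _); case: (par _).
rewrite /B delta_br mulmxBl mulmxBr !opprB; set w := _ *m (_ *: delta (b.1, _)).
by rewrite ![w - _]addrC !addrA (addrAC _ (- (_ *: delta (b.1, _) *m Y))).
Qed.

End Adjoint.

(** * Leading parts *)

Section Leading.
Variables (F : fieldType) (T : finType) (par jp : T -> bool) (d : nat).
Local Notation word := {ffun 'I_d -> T}.
Local Notation Gn := (T * T)%type.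
Local Notation mtx := 'M[F]_#|{ffun 'I_d -> T}|.
Local Notation E := (@unit_op F T par d).
Local Notation gp := (gen_par par).
Local Notation sg := (bsgn F).
Local Notation delta := (@total_op F T par d).
Local Notation jm := (@side_op F T jp d).
Local Notation jx := (side_change jp).
Local Notation mp := (@slot_prod F T par d).
Local Notation sgm := (@parity_conj F T par d).
Local Notation ad := (@sad F T par d).
Local Notation slots u := [seq x.1 | x <- u].

Definition ndiff (x y : word) : nat := #|[pred k | jp (x k) != jp (y k)]|.

(** Operator counterpart of [filt]: a letter changes the side of one slot at most, so [ad] raises
    the bound by at most one. The refinement [flips_in] records the slots, since a second letter in
    the same slot costs nothing. *)
Definition flips_lt r (Y : mtx) := forall x y, entry Y x y != 0 -> (ndiff x y < r)%N.
Definition flips_in (K : seq 'I_d) (Y : mtx) :=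
  forall x y, entry Y x y != 0 -> forall k, k \notin K -> jp (x k) = jp (y k).

Lemma flips_ltD r Y Z : flips_lt r Y -> flips_lt r Z -> flips_lt r (Y + Z).
Proof.
move=> HY HZ x y; rewrite entD; have [Y0|/HY //] := eqVneq (entry Y x y) 0.
by rewrite Y0 add0r => /HZ.
Qed.

Lemma flips_ltZ r c Y : flips_lt r Y -> flips_lt r (c *: Y).
Proof. by move=> HY x y; rewrite entZ mulf_eq0 negb_or => /andP[_ /HY]. Qed.

Lemma flips_ltB r Y Z : flips_lt r Y -> flips_lt r Z -> flips_lt r (Y - Z).
Proof. by move=> HY HZ; apply: flips_ltD => //; rewrite -scaleN1r; apply: flips_ltZ. Qed.

Lemma flips_lt_sum r (J : eqType) (s : seq J) (P : pred J) (G : J -> mtx) :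
  (forall i, i \in s -> P i -> flips_lt r (G i)) -> flips_lt r (\sum_(i <- s | P i) G i).
Proof.
move=> HG; rewrite big_seq_cond; apply: big_ind => [x y||i /andP[si Pi]].
- by rewrite ent0 eqxx.
- exact: flips_ltD.
- exact: HG.
Qed.

Lemma flips_lt_leq r s Y : (r <= s)%N -> flips_lt r Y -> flips_lt s Y.
Proof. by move=> rs HY x y /HY /leq_trans; apply. Qed.

Lemma flips_in_lt K Y : flips_in K Y -> flips_lt (size K).+1 Y.
Proof.
move=> HY x y /HY Yk; rewrite ltnS; apply: leq_trans (card_size K).
by apply/subset_leq_card/subsetP=> k; rewrite inE; apply: contraNT => /Yk ->.
Qed.

Lemma ent_E k a x y : entry (E k a) x y != 0 -> [/\ x = upd y k a.1, y k = a.2 & x k = a.1].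
Proof.
rewrite ent_mono; have [->|_] := eqVneq x; last by rewrite mulr0 eqxx.
by have [->|_] := eqVneq (y k) a.2; rewrite ?mul0r ?eqxx // updE eqxx.
Qed.

Lemma ent_mul_neq0 (Y Z : mtx) x z : entry (Y *m Z) x z != 0 ->
  exists y, entry Y x y != 0 /\ entry Z y z != 0.
Proof.
rewrite ent_mul => /eqP nz.
have [y] : exists y, entry Y x y * entry Z y z != 0.
  apply/existsP; apply: contra_notT nz => /existsPn nz.
  by apply: big1 => y _; have /negPn/eqP := nz y.
by rewrite mulf_eq0 negb_or => /andP[Yn Zn]; exists y.
Qed.

Lemma ndiff1 (x y z : word) k : (forall m, m != k -> x m = y m) ->
  (ndiff x z <= (ndiff y z).+1)%N.
Proof.
move=> xy; rewrite /ndiff (cardD1 k) -add1n; apply: leq_add; first exact: leq_b1.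
apply/subset_leq_card/subsetP=> m; rewrite !inE => /andP[mk].
by rewrite (xy m mk).
Qed.

Lemma ndiffC x y : ndiff x y = ndiff y x.
Proof. by apply: eq_card => k; rewrite !inE eq_sym. Qed.

Lemma flips_lt_E r k a Y : flips_lt r Y -> flips_lt r.+1 (E k a *m Y).
Proof.
move=> HY x z /ent_mul_neq0[y [/ent_E[-> _ _] /HY yz]]; rewrite ltnS.
apply: leq_trans yz; apply: (@ndiff1 _ _ _ k) => m mk.
by rewrite updE (negbTE mk).
Qed.

Lemma flips_lt_Er r k a Y : flips_lt r Y -> flips_lt r.+1 (Y *m E k a).
Proof.
move=> HY x z /ent_mul_neq0[y [/HY xy /ent_E[yE _ _]]]; rewrite ltnS.
apply: leq_trans xy; rewrite ndiffC [ndiff x y]ndiffC; apply: (@ndiff1 _ _ _ k) => m mk.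
by rewrite yE updE (negbTE mk).
Qed.

Lemma ent_sgm b Y x y : entry (sgm b Y) x y != 0 -> entry Y x y != 0.
Proof.
case: b => //; rewrite /parity_conj ent_Mdg ent_dgM; apply: contraNneq => ->.
by rewrite mulr0 mul0r.
Qed.

Lemma flips_lt_sgm r b Y : flips_lt r Y -> flips_lt r (sgm b Y).
Proof. by move=> HY x y /ent_sgm /HY. Qed.

Lemma flips_lt_ad r a Y : flips_lt r Y -> flips_lt r.+1 (ad a Y).
Proof.
move=> HY; rewrite /sad /total_op mulmx_suml mulmx_sumr; apply: flips_ltB.
  by apply: flips_lt_sum => k _ _; apply: flips_lt_E.
by apply: flips_lt_sum => k _ _; apply/flips_lt_Er/flips_lt_sgm.
Qed.

Lemma flips_in_E K k a Y : (k \in K) || ~~ jx a -> flips_in K Y -> flips_in K (E k a *m Y).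
Proof.
move=> kK HY x z /ent_mul_neq0[y [/ent_E[xE ya xa] /HY yz]] m mK.
rewrite -(yz m mK) xE updE; case: eqP => // mk; move: mK; rewrite mk.
by case/orP: kK => [->//|ja _]; move: ja; rewrite /jx ya negb_add => /eqP.
Qed.

Lemma flips_in_Er K k a Y : (k \in K) || ~~ jx a -> flips_in K Y -> flips_in K (Y *m E k a).
Proof.
move=> kK HY x z /ent_mul_neq0[y [/HY xy /ent_E[yE za ya]]] m mK.
rewrite (xy m mK) yE updE; case: eqP => // mk; move: mK; rewrite mk.
by case/orP: kK => [->//|ja _]; move: ja; rewrite /jx za negb_add => /eqP.
Qed.

Lemma flips_in_dg K c Y : flips_in K Y -> flips_in K (Y *m diag c).
Proof. by move=> HY x y; rewrite ent_Mdg mulf_eq0 negb_or => /andP[/HY]. Qed.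

Lemma flips_in_sgm K b Y : flips_in K Y -> flips_in K (sgm b Y).
Proof. by move=> HY x y /ent_sgm /HY. Qed.

Lemma flips_in_mp u : flips_in (slots u) (mp u).
Proof.
elim: u => [|x u IH] /=.
  rewrite -mono1 => x y; rewrite ent_mono; by case: (x =P id y) => [-> //|_]; rewrite mulr0 eqxx.
apply: flips_in_E; first by rewrite inE eqxx.
by move=> y z /IH yz k; rewrite inE negb_or => /andP[_ /yz].
Qed.

Definition J_op : mtx := jm [ffun=> true].
Local Notation jj := J_op.

Lemma jj_E k a : jj *m E k a = sg (jx a) *: (E k a *m jj).
Proof. by rewrite jm_E ffunE. Qed.

Lemma jj_sq : jj *m jj = 1%:M. Proof. exact: jm_sq. Qed.

Lemma sgm_jj b : sgm b jj = jj.
Proof.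
case: b => //; rewrite /parity_conj !dg_mul; apply: mono_ext => // y.
by rewrite mulrAC sg_sq mul1r.
Qed.

Lemma jj_delta b : ~~ jx b -> jj *m delta b = delta b *m jj.
Proof.
move=> /negbTE Kb; rewrite mulmx_sumr mulmx_suml; apply: eq_bigr => k _.
by rewrite jj_E Kb scale1r.
Qed.

Lemma ad_jj b : ~~ jx b -> ad b jj = 0.
Proof. by move=> Kb; rewrite /sad sgm_jj jj_delta // subrr. Qed.

(** The ways of putting [l] letters into distinct slots, d! of them for [l = d]; only the positivity
    of the number matters. *)
Fixpoint injections (l : nat) : seq (seq 'I_d) :=
  if l is l'.+1 then
    flatten [seq [seq k :: ks | k <- enum 'I_d & k \notin ks] | ks <- injections l']
  else [:: [::]].

Lemma injectionsP l ks : ks \in injections l -> uniq ks /\ size ks = l.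
Proof.
elim: l ks => [|l IH] ks /=; first by rewrite inE => /eqP ->.
case/flatten_mapP => ks' /IH[uks' sks'] /mapP[k]; rewrite mem_filter => /andP[kks _] ->.
by rewrite /= kks uks' sks'.
Qed.

Lemma injections_neq0 l : (l <= d)%N -> (0 < size (injections l))%N.
Proof.
elim: l => // l IH ld; have := IH (ltnW ld).
case E: (injections l) => [//|ks s] _; rewrite /= E /=.
have [uks sks] : uniq ks /\ size ks = l by apply: injectionsP; rewrite E mem_head.
rewrite size_cat; apply: ltn_addr; rewrite size_map size_filter -has_count.
apply/hasP; have : ~~ (enum 'I_d \subset ks).
  apply: contraTN ld => /subset_leq_card; rewrite -ltnNge ltnS.
  rewrite (eq_card (mem_enum 'I_d)) card_ord => dk.
  by rewrite -sks; apply: leq_trans dk (card_size _).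
by case/subsetPn => k ke kn; exists k.
Qed.

Definition placements (w : seq Gn) : mtx := \sum_(ks <- injections (size w)) mp (zip ks w).
Local Notation place := placements.

Lemma place_cons a w : place (a :: w) =
  \sum_(ks <- injections (size w)) \sum_(k | k \notin ks) E k a *m mp (zip ks w).
Proof.
rewrite /place /= big_flatten big_map; apply: eq_bigr => ks _.
by rewrite big_map big_filter big_enum_cond.
Qed.

Lemma slots_zip (ks : seq 'I_d) (w : seq Gn) : size ks = size w -> slots (zip ks w) = ks.
Proof. by move=> sk; rewrite -/(unzip1 _) unzip1_zip // sk. Qed.

(** An occupied slot yields no new flip. In a free slot the sign from passing [mp u] cancels the
    parity twist and passing [jj] leaves the factor [1 - sg (jx a)]. It is 2 for a side-changing
    letter; for a letter of k it is 0, and the subtracted term falls under the bound. *)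
Lemma ad_mp a u : uniq (slots u) ->
  flips_lt (size u).+1 (ad a (mp u *m jj) - 2%:R *: (\sum_(k | k \notin slots u) E k a *m mp u *m jj)).
Proof.
move=> uu; have Hu : flips_in (slots u) (mp u *m jj) by apply/flips_in_dg/flips_in_mp.
have inH Y : flips_in (slots u) Y -> flips_lt (size u).+1 Y.
  by move=> /flips_in_lt; rewrite size_map.
rewrite /sad /total_op mulmx_suml mulmx_sumr -sumrB (bigID (mem (slots u))) /=.
rewrite -addrA scaler_sumr -sumrB; apply: flips_ltD.
  apply: flips_lt_sum => k _ ku; apply/inH => x y; rewrite -scaleN1r entD entZ => xy m.
  have: (entry (E k a *m (mp u *m jj)) x y != 0) || (entry (sgm (gp a) (mp u *m jj) *m E k a) x y != 0).
    apply: contra_neqT xy; rewrite negb_or !negbK => /andP[/eqP -> /eqP ->].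
    by rewrite mulr0 addr0.
  have kK : (k \in slots u) || ~~ jx a by rewrite ku.
  case/orP => xy'; first exact: (flips_in_E kK Hu xy').
  exact: (flips_in_Er kK (flips_in_sgm Hu) xy').
apply: flips_lt_sum => k _ ku.
have -> : sgm (gp a) (mp u *m jj) *m E k a = sg (jx a) *: (E k a *m mp u *m jj).
  rewrite sgmM sgm_jj -mulmxA jj_E -scalemxAr sgm_mp mulmxA -scalemxAl.
  by rewrite (E_mp F par a ku).
rewrite mulmxA; case ja: (jx a).
  rewrite /bsgn scaleN1r opprK -mulr2n -scaler_nat subrr => x y.
  by rewrite ent0 eqxx.
rewrite scale1r subrr sub0r -scaleN1r; apply/flips_ltZ/flips_ltZ/inH; rewrite -mulmxA.
by apply: flips_in_E Hu; rewrite ja orbT.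
Qed.

Definition sad_word (w : seq Gn) (Y : mtx) : mtx := foldr ad Y w.
Local Notation adw := sad_word.

(* A second letter in a slot wastes a factor, so only injective placements of the
   letters reach the top number of slots exchanging the two eigenspaces of J. *)
Lemma adw_place w : flips_lt (size w) (adw w jj - 2%:R ^+ size w *: (place w *m jj)).
Proof.
elim: w => [|a w IH] /=.
  rewrite /place /= big_seq1 mul1mx scale1r subrr => x y; by rewrite ent0 eqxx.
rewrite place_cons -/(adw w jj); set l := size w.
have -> : ad a (adw w jj) = ad a (adw w jj - 2%:R ^+ l *: (place w *m jj))
     + 2%:R ^+ l *: ad a (place w *m jj).
  by rewrite -adZ -adD subrK.
rewrite -addrA; apply: flips_ltD; first exact: flips_lt_ad.
rewrite exprSr -scalerA -scalerBr; apply: flips_ltZ.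
rewrite /place !mulmx_suml ad_sum scaler_sumr -sumrB big_seq; apply: flips_lt_sum => ks _ kl.
have [uks sks] := injectionsP kl.
rewrite mulmx_suml; have := @ad_mp a (zip ks w).
by rewrite slots_zip // size_zip sks minnn; apply.
Qed.

Lemma place_Hlt w : flips_lt (size w).+1 (place w *m jj).
Proof.
rewrite /place mulmx_suml big_seq; apply: flips_lt_sum => ks _ kl; have [uks sks] := injectionsP kl.
have := flips_in_lt (flips_in_dg (c := fun y => sg (side_parity jp [ffun=> true] y)) (@flips_in_mp (zip ks w))).
by rewrite slots_zip // sks.
Qed.

Definition opposite (x y : word) : bool := [forall k, jp (x k) != jp (y k)].
Local Notation opp := opposite.
(** Anticommuting with J in a slot means that every nonzero entry changes side there, so this
    component is cut out entrywise. *)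
Definition opposite_part (Y : mtx) : mtx := mat (fun x y => (opp x y)%:R * entry Y x y).
Local Notation prj := opposite_part.

Lemma ent_prj Y x y : entry (prj Y) x y = (opp x y)%:R * entry Y x y.
Proof. exact: ent_mat. Qed.

Lemma prjD Y Z : prj (Y + Z) = prj Y + prj Z.
Proof. by apply: entP => x y; rewrite entD !ent_prj entD mulrDr. Qed.

Lemma prjZ c Y : prj (c *: Y) = c *: prj Y.
Proof. by apply: entP => x y; rewrite entZ !ent_prj entZ mulrCA. Qed.

Lemma prj_sum (J : Type) (r : seq J) (P : pred J) (G : J -> mtx) :
  prj (\sum_(i <- r | P i) G i) = \sum_(i <- r | P i) prj (G i).
Proof.
apply: (big_morph prj prjD).
by have := prjZ 0 0; rewrite !scale0r.
Qed.

Lemma prj_Hlt Y : flips_lt d Y -> prj Y = 0.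
Proof.
move=> HY; apply: entP => x y; rewrite ent0 ent_prj.
case: (boolP (opp x y)) => [/forallP oxy|_]; last by rewrite mul0r.
rewrite mul1r; apply/eqP; apply: contraT => /HY.
by rewrite /ndiff (eq_card (B := 'I_d)) ?card_ord ?ltnn // => k; rewrite !inE oxy.
Qed.

Lemma prj_dg Y c : prj (Y *m diag c) = prj Y *m diag c.
Proof. by apply: entP => x y; rewrite ent_Mdg !ent_prj ent_Mdg mulrA. Qed.

Lemma prj_idem Y : prj (prj Y) = prj Y.
Proof. by apply: entP => x y; rewrite !ent_prj mulrA -natrM mulnb andbb. Qed.

Lemma opp_trans (x y z : word) : (forall k, jp (x k) = jp (y k)) -> opp x z = opp y z.
Proof. by move=> xy; apply: eq_forallb => k; rewrite xy. Qed.

Lemma oppC x y : opp x y = opp y x.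
Proof. by apply: eq_forallb => k; rewrite eq_sym. Qed.

Lemma ent_E_K k b x y : ~~ jx b -> entry (E k b) x y != 0 -> forall m, jp (x m) = jp (y m).
Proof.
move=> Kb /ent_E[-> yb _] m; rewrite updE; case: eqP => // ->.
by move: Kb; rewrite /jx negb_add yb => /eqP.
Qed.

Lemma prj_delta b Y : ~~ jx b -> prj (delta b *m Y) = delta b *m prj Y.
Proof.
move=> Kb; rewrite !mulmx_suml prj_sum; apply: eq_bigr => k _.
apply: entP => x y; rewrite ent_prj !ent_mul mulr_sumr; apply: eq_bigr => z _.
have [->|/(ent_E_K Kb)/opp_trans -> ] := eqVneq (entry (E k b) x z) 0.
  by rewrite !mul0r mulr0.
by rewrite ent_prj mulrCA.
Qed.

Lemma prj_delta_r b Y : ~~ jx b -> prj (Y *m delta b) = prj Y *m delta b.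
Proof.
move=> Kb; rewrite !mulmx_sumr prj_sum; apply: eq_bigr => k _.
apply: entP => x y; rewrite ent_prj !ent_mul mulr_sumr; apply: eq_bigr => z _.
have [->|/(ent_E_K Kb)/opp_trans zy] := eqVneq (entry (E k b) z y) 0.
  by rewrite !mulr0.
by rewrite ent_prj oppC -zy oppC mulrA.
Qed.

Lemma prj_sgm b Y : prj (sgm b Y) = sgm b (prj Y).
Proof.
case: b => //; rewrite /parity_conj prj_dg; congr (_ *m _).
by apply: entP => x y; rewrite ent_dgM !ent_prj ent_dgM mulrCA.
Qed.

Lemma prj_ad b Y : ~~ jx b -> prj (ad b Y) = ad b (prj Y).
Proof.
move=> Kb; rewrite /sad prjD prj_delta // -scaleN1r prjZ prj_delta_r //.
by rewrite prj_sgm scaleN1r.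
Qed.

(** The error in [adw_place] flips fewer than [size w <= d] slots and dies under [prj]; for a
    shorter word the main term dies as well. *)
Lemma prj_adw w : (size w <= d)%N ->
  prj (adw w jj) = 2%:R ^+ d *: (if size w == d then prj (place w) *m jj else 0).
Proof.
move=> wd; have:= prj_Hlt (flips_lt_leq wd (@adw_place w)).
rewrite prjD -scaleN1r !prjZ scaleN1r => /eqP; rewrite subr_eq0 => /eqP ->.
case: eqP => [->|/eqP nwd]; first by rewrite prj_dg.
rewrite prj_Hlt ?scaler0 //.
by apply: flips_lt_leq (@place_Hlt w); rewrite ltn_neqAle nwd.
Qed.

End Leading.

(** * Absorbing the factors J *)

Section Symmetrisation.
Variables (F : fieldType) (T : finType) (par jp : T -> bool) (d : nat).
Hypothesis char0 : forall n, (n%:R == 0 :> F) = (n == 0)%N.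
Local Notation word := {ffun 'I_d -> T}.
Local Notation mtx := 'M[F]_#|{ffun 'I_d -> T}|.
Local Notation rp := (@perm_op F T par d).
Local Notation sg := (bsgn F).
Local Notation delta := (@total_op F T par d).
Local Notation jm := (@side_op F T jp d).
Local Notation sgm := (@parity_conj F T par d).
Local Notation prj := (@opposite_part F T jp d).
Local Notation grp := ({ffun 'I_d -> bool} * 'S_d)%type.
Local Notation rho := (@grp_op F T par jp d).

Lemma natr_inj m n : m%:R = n%:R :> F -> m = n.
Proof.
wlog le : m n / (m <= n)%N => [wl|/eqP].
  by case/orP: (leq_total m n) => le; [|move/esym]; move/(wl _ _ le).
by rewrite eq_sym -subr_eq0 -natrB // char0 subn_eq0 => le'; apply/eqP; rewrite eqn_leq le.
Qed.

Lemma delta_diag i : delta (i, i) = diag (fun y => #|[pred k | y k == i]|%:R).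
Proof.
apply: entP => x y; rewrite ent_sum ent_mono -sum1_card natr_sum mulr_suml [RHS]big_mkcond /=.
apply: eq_bigr => k _; rewrite ent_mono /gen_par /= addbb mulr1 inE.
case: eqP => [yk|]; rewrite ?mul0r // !mul1r.
suff -> : upd y k i = y by [].
by apply/ffunP=> m; rewrite updE; case: eqP => // ->.
Qed.

(* Commuting with all E_ii preserves the content of a word, hence its parity. *)
Lemma sgm_weight0 b (M : mtx) :
  (forall i, M *m delta (i, i) = delta (i, i) *m M) -> sgm b M = M.
Proof.
move=> Mi; case: b => //; rewrite /parity_conj; apply: entP => x y.
rewrite ent_Mdg ent_dgM; have [->|Mxy] := eqVneq (entry M x y) 0; first by rewrite mulr0 mul0r.
suff -> : pre_parity par d x = pre_parity par d y by rewrite mulrAC sg_sq mul1r.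
have cnt i : #|[pred k | x k == i]| = #|[pred k | y k == i]|.
  have /(congr1 (fun N => entry N x y)) := Mi i.
  by rewrite delta_diag ent_Mdg ent_dgM mulrC => /(mulIf Mxy)/natr_inj ->.
(* The parity of a word depends only on how often each letter occurs. *)
have preE (z : word) : pre_parity par d z = \big[addb/false]_i (par i && odd #|[pred k | z k == i]|).
  rewrite /pre_parity big_mkcond /=.
  transitivity (\big[addb/false]_k \big[addb/false]_i (par i && (z k == i))).
    apply: eq_bigr => k _; rewrite ltn_ord (bigD1 (z k)) //= eqxx andbT big1 ?addbF // => i.
    by rewrite eq_sym => /negbTE ->; rewrite andbF.
  rewrite exchange_big; apply: eq_bigr => i _; rewrite -big_distrr /=; congr (_ && _).
  rewrite -sum1_card (big_morph odd oddD (erefl _)) [RHS]big_mkcond /=.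
  by apply: eq_bigr => k _; rewrite inE; case: eqP.
by rewrite !preE; apply: eq_bigr => i _; rewrite cnt.
Qed.

Definition jset (y : word) : {set 'I_d} := [set k | jp (y k)].
(** The joint eigenprojections of the J factors; every [jm e] is a signed sum of them. *)
Definition side_proj (S : {set 'I_d}) : mtx := diag (fun y => (jset y == S)%:R).
Definition swaps (s : 'S_d) (S : {set 'I_d}) := [forall k, (s k \in S) != (k \in S)].

Lemma jm_dS e : jm e = \sum_(S : {set 'I_d}) sg (\big[addb/false]_k (e k && (k \notin S))) *: side_proj S.
Proof.
apply: entP => x y; rewrite ent_sum (bigD1 (jset y)) //= [X in _ + X]big1 ?addr0.
  rewrite entZ !ent_mono eqxx mul1r; congr (sg _ * _).
  by apply: eq_bigr => k _; rewrite inE.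
by move=> S yS; rewrite entZ ent_mono eq_sym (negbTE yS) mul0r mulr0.
Qed.

Lemma sum_dS : \sum_S side_proj S = 1%:M.
Proof.
rewrite -mono1; apply: entP => x y; rewrite ent_sum (bigD1 (jset y)) //= [X in _ + X]big1 ?addr0.
  by rewrite !ent_mono eqxx.
by move=> S yS; rewrite ent_mono eq_sym (negbTE yS) mul0r.
Qed.

(** Row words have pattern [S] and column words have it transported by [s]; they are opposite in
    every slot exactly when [s] exchanges [S] with its complement. *)
Lemma prj_dS_rp S s : prj (side_proj S *m rp s) = (swaps s S)%:R *: (side_proj S *m rp s).
Proof.
apply: entP => x y; rewrite ent_prj entZ ent_dgM ent_mono.
case: (x =P precomp s y) => [->|_]; last by rewrite !mulr0.
case: (jset _ =P S) => [<-|_]; last by rewrite !mul0r !mulr0.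
congr ((nat_of_bool _)%:R * _).
apply/forallP/forallP => H k; first by move: (H (s k)); rewrite !inE !ffunE.
by move: (H (s^-1%g k)); rewrite !inE !ffunE permKV.
Qed.

Lemma rp_dS c S : rp c *m side_proj S = side_proj (c @^-1: S) *m rp c.
Proof.
rewrite /side_proj /perm_op /diag !mono_mul; apply: mono_ext => //= y; rewrite mulrC; congr (_ * _%:R).
suff -> : jset (precomp c y) = c @^-1: (jset y).
  congr (nat_of_bool _); apply/eqP/eqP => [<- //|/setP pre_eq].
  by apply/setP=> k; have := pre_eq (c^-1%g k); rewrite !inE permKV.
by apply/setP=> k; rewrite !inE ffunE.
Qed.

(* The conjugator is s on the s-stable set where S and S' differ, the identity elsewhere. *)
Lemma swaps_conj s S S' : swaps s S -> swaps s S' ->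
  exists c : 'S_d, rp c *m (side_proj S *m rp s) *m rp c^-1%g = side_proj S' *m rp s.
Proof.
move=> /forallP sS /forallP sS'.
pose D k := (k \in S) != (k \in S').
have Ds k : D (s k) = D k.
  by rewrite /D; move: (sS k) (sS' k); do 4 case: (_ \in _).
pose f k := if D k then s k else k.
have finj : injective f.
  move=> k l; rewrite /f; case Dk: (D k); case Dl: (D l) => //; first exact: perm_inj.
    by move=> skl; move: Dl; rewrite -skl Ds Dk.
  by move=> skl; move: Dk; rewrite skl Ds Dl.
exists (perm finj); set c := perm finj.
have cs : (c * s = s * c)%g.
  by apply/permP=> k; rewrite !permM !permE /f Ds; case: (D k).
have -> : rp c *m (side_proj S *m rp s) = side_proj S' *m rp s *m rp c.
  rewrite mulmxA rp_dS -!mulmxA -!rpM cs; congr (side_proj _ *m _).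
  apply/setP=> k; rewrite inE permE /f; case Dk: (D k).
    by move: Dk (sS k); rewrite /D; do 3 case: (_ \in _).
  by move: Dk; rewrite /D => /negbFE/eqP.
by rewrite -mulmxA rpV mulmx1.
Qed.

Section Modulo.
Variable Q : mtx -> Prop.
Hypothesis QD : forall Y Z, Q Y -> Q Z -> Q (Y + Z).
Hypothesis QZ : forall c Y, Q Y -> Q (c *: Y).
Hypothesis Q_conj : forall c Y, Q (rp c *m Y *m rp c^-1%g - Y).
Hypothesis Q_prj : forall Y, Q (prj Y - Y).

Lemma Q_sum (J : finType) (P : pred J) (G : J -> mtx) :
  (forall i, P i -> Q (G i)) -> Q (\sum_(i | P i) G i).
Proof.
move=> QG; apply: big_ind => //.
by have := @QZ 0 _ (Q_prj 0); rewrite scale0r.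
Qed.

(** The patterns exchanged by [s] are conjugate under permutations commuting with [s], so their
    terms agree modulo [Q]. Their sum is [prj (rp s)], which is [rp s] modulo [Q]; each is therefore
    [rp s] divided by their number. Later [Q Y] will say that [phi Y] is of lower order. *)
Lemma Q_dS s S : swaps s S -> exists a, Q (side_proj S *m rp s - a *: rp s).
Proof.
move=> sS; pose N := #|[pred S | swaps s S]|.
have N0 : N%:R != 0 :> F by rewrite char0 -lt0n; apply/card_gt0P; exists S.
exists N%:R^-1.
have -> : side_proj S *m rp s - N%:R^-1 *: rp s = N%:R^-1 *:
   (\sum_(S' | swaps s S') (side_proj S *m rp s - side_proj S' *m rp s) + (prj (rp s) - rp s)).
  have -> : prj (rp s) = \sum_(S' | swaps s S') side_proj S' *m rp s.
    rewrite -{1}[rp s]mul1mx -sum_dS mulmx_suml prj_sum [RHS]big_mkcond.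
    apply: eq_bigr => S' _; rewrite prj_dS_rp.
    by case: swaps; rewrite ?scale1r ?scale0r.
  rewrite sumrB addrA subrK sumr_const scalerBr -scaler_nat scalerA mulVf //.
  by rewrite scale1r.
apply/QZ/QD; last exact: Q_prj.
apply: Q_sum => S' sS'; have [c <-] := swaps_conj sS' sS.
exact: Q_conj.
Qed.

(** [prj M = M] discards the patterns not exchanged by the permutation, and [Q_dS] applies to every
    remaining term. *)
Lemma span_rp_mod (M : mtx) (c : grp -> F) : M = \sum_g c g *: rho g -> prj M = M ->
  exists c' : 'S_d -> F, Q (M - \sum_s c' s *: rp s).
Proof.
move=> ME MP.
have aP (sS : 'S_d * {set 'I_d}) : exists a, swaps sS.1 sS.2 -> Q (side_proj sS.2 *m rp sS.1 - a *: rp sS.1).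
  case: (boolP (swaps sS.1 sS.2)) => [/Q_dS[a Qa]|_]; first by exists a.
  by exists 0.
have [a aQ] := fin_all_exists aP.
pose chi (e : {ffun 'I_d -> bool}) (S : {set 'I_d}) := sg (\big[addb/false]_k (e k && (k \notin S))).
pose b (e : {ffun 'I_d -> bool}) s S := c (e, s) * chi e S * (swaps s S)%:R.
exists (fun s => \sum_(e : {ffun 'I_d -> bool}) \sum_(S : {set 'I_d}) b e s S * a (s, S)).
have -> : M = \sum_s \sum_e \sum_S b e s S *: (side_proj S *m rp s).
  rewrite -MP ME prj_sum [RHS]exchange_big /=.
  rewrite (eq_bigr (fun g => prj (c (g.1, g.2) *: rho (g.1, g.2)))); last by case.
  rewrite -(pair_bigA _ (fun e s => prj (c (e, s) *: rho (e, s)))) /=.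
  apply: eq_bigr => e _; apply: eq_bigr => s _.
  rewrite prjZ /grp_op jm_dS mulmx_suml prj_sum scaler_sumr; apply: eq_bigr => S _.
  by rewrite -scalemxAl prjZ prj_dS_rp !scalerA.
rewrite -sumrB; apply: Q_sum => s _; rewrite scaler_suml -sumrB; apply: Q_sum => e _.
rewrite scaler_suml -sumrB; apply: Q_sum => S _; rewrite -scalerA -scalerBr.
rewrite /b; case: (boolP (swaps s S)) => [sS|_]; first exact/QZ/(aQ (s, S)).
by rewrite mulr0 scale0r; have := @QZ 0 _ (Q_prj 0); rewrite scale0r.
Qed.

End Modulo.
End Symmetrisation.

(** * Operators as tensors of letters *)

Section Coordinates.
Variables (F : fieldType) (T : finType) (par : T -> bool) (d : nat).
Local Notation word := {ffun 'I_d -> T}.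
Local Notation Gn := (T * T)%type.
Local Notation mtx := 'M[F]_#|{ffun 'I_d -> T}|.
Local Notation E := (@unit_op F T par d).
Local Notation rp := (@perm_op F T par d).
Local Notation gp := (gen_par par).
Local Notation sg := (bsgn F).
Local Notation slot := ('I_d * Gn)%type.
Local Notation delta := (@total_op F T par d).
Local Notation mp := (@slot_prod F T par d).
Local Notation word_unit := (@word_unit F T d).
Local Notation sgm := (@parity_conj F T par d).
Local Notation ad := (@sad F T par d).
Local Notation slots u := [seq x.1 | x <- u].

Lemma mtx_ind (P : mtx -> Prop) : P 0 ->
  (forall Y Z, P Y -> P Z -> P (Y + Z)) -> (forall c Y, P Y -> P (c *: Y)) ->
  (forall x y, P (mp (graph x y))) -> forall Y, P Y.
Proof.
move=> P0 PD PZ Pg Y; rewrite [Y]mtx_dmx.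
apply: big_ind => // x _; apply: big_ind => // y _; apply/PZ.
have [e mpE] := mp_graph F par x y.
have -> : word_unit x y = sg e *: mp (graph x y) by rewrite mpE scalerA sg_sq scale1r.
exact/PZ/Pg.
Qed.

Section Phi.
Variables (V : lmodType F) (g : word -> word -> V).

(** The linear map sending the basis element [mp (graph x y)] to [g x y]. The second entry is the
    sign between that product and the matrix unit, and is its own inverse. *)
Definition Phi (Y : mtx) : V :=
  \sum_x \sum_y (entry Y x y * entry (mp (graph x y)) x y) *: g x y.

Lemma PhiD Y Z : Phi (Y + Z) = Phi Y + Phi Z.
Proof.
rewrite /Phi -big_split; apply: eq_bigr => x _; rewrite -big_split.
by apply: eq_bigr => y _; rewrite entD mulrDl scalerDl.
Qed.

Lemma PhiZ c Y : Phi (c *: Y) = c *: Phi Y.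
Proof.
rewrite /Phi scaler_sumr; apply: eq_bigr => x _; rewrite scaler_sumr.
by apply: eq_bigr => y _; rewrite entZ scalerA mulrA.
Qed.

Lemma Phi0 : Phi 0 = 0.
Proof. by have := PhiZ 0 0; rewrite !scale0r. Qed.

Lemma PhiB Y Z : Phi (Y - Z) = Phi Y - Phi Z.
Proof. by rewrite PhiD -(scaleN1r Z) PhiZ scaleN1r. Qed.

Lemma Phi_sum (J : Type) (r : seq J) (P : pred J) (G : J -> mtx) :
  Phi (\sum_(i <- r | P i) G i) = \sum_(i <- r | P i) Phi (G i).
Proof. exact: (big_morph Phi PhiD Phi0). Qed.

Lemma Phi_graph x y : Phi (mp (graph x y)) = g x y.
Proof.
have [e mpE] := mp_graph F par x y.
have entE x' y' : entry (word_unit x y) x' y' = ((x' == x) && (y' == y))%:R.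
  by rewrite ent_mono -natrM mulnb andbC.
rewrite /Phi (bigD1 x) //= [X in _ + X]big1 ?addr0 => [|x' xx]; last first.
  by rewrite big1 // => y' _; rewrite mpE entZ entE (negbTE xx) mulr0 mul0r scale0r.
rewrite (bigD1 y) //= [X in _ + X]big1 ?addr0 => [|y' yy]; last first.
  by rewrite mpE entZ entE (negbTE yy) andbF mulr0 mul0r scale0r.
by rewrite mpE entZ entE !eqxx mulr1 sg_sq scale1r.
Qed.

End Phi.

Lemma slots_fun (u : seq slot) : uniq (slots u) -> slots u =i 'I_d ->
  exists x y : word, forall z, z \in u -> z = (z.1, (x z.1, y z.1)).
Proof.
move=> uu uT.
have uniq_u k a b : (k, a) \in u -> (k, b) \in u -> a = b.
  elim: u uu {uT} => //= -[l c] u IH /andP[/= lu uu].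
  rewrite !inE => /orP[/eqP[kl ->]|ka] /orP[/eqP[kl' ->]|kb] //.
  - by move: lu; rewrite -kl; have /= -> := map_f fst kb.
  - by move: lu; rewrite -kl'; have /= -> := map_f fst ka.
  - exact: IH.
have /fin_all_exists[a au] (k : 'I_d) : exists a, (k, a) \in u.
  have : k \in slots u by rewrite uT.
  by case/mapP=> -[l b] lb ->; exists b.
exists [ffun k => (a k).1], [ffun k => (a k).2] => -[k b] kb /=.
by rewrite !ffunE -surjective_pairing; congr (_, _); apply: uniq_u kb (au k).
Qed.

Lemma slots_enum (u : seq slot) : slots u = enum 'I_d -> exists x y, u = graph x y.
Proof.
move=> su; have [| |x [y xy]] := @slots_fun u; rewrite ?su ?enum_uniq //.
  by move=> k; rewrite mem_enum.
exists x, y; rewrite /graph -su -map_comp -[LHS]map_id.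
by apply/eq_in_map => z /xy.
Qed.

Lemma slots_perm (u : seq slot) : perm_eq (slots u) (enum 'I_d) ->
  exists x y, perm_eq u (graph x y).
Proof.
move=> su; have uu : uniq (slots u) by rewrite (perm_uniq su) enum_uniq.
have uT : slots u =i 'I_d by move=> k; rewrite (perm_mem su) mem_enum.
have [x [y xy]] := slots_fun uu uT; exists x, y.
apply: uniq_perm; first exact: map_uniq uu.
  by apply: (@map_uniq _ _ fst); rewrite slots_graph enum_uniq.
move=> z; apply/idP/idP => [zu|/mapP[k _ ->]].
  by rewrite [z]xy //; apply/mapP; exists z.1; rewrite // mem_enum.
have : k \in slots u by rewrite uT.
by case/mapP => t tu ->; rewrite -xy.
Qed.

Lemma conj_subD c (Y Z : mtx) : rp c *m (Y + Z) *m rp c^-1%g - (Y + Z) =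
  (rp c *m Y *m rp c^-1%g - Y) + (rp c *m Z *m rp c^-1%g - Z).
Proof. by rewrite mulmxDr mulmxDl opprD addrACA. Qed.

Lemma conj_subZ c a (Y : mtx) : rp c *m (a *: Y) *m rp c^-1%g - a *: Y =
  a *: (rp c *m Y *m rp c^-1%g - Y).
Proof. by rewrite -scalemxAr -scalemxAl scalerBr. Qed.

Lemma prj_subD jp (Y Z : mtx) : opposite_part jp (Y + Z) - (Y + Z) =
  (opposite_part jp Y - Y) + (opposite_part jp Z - Z).
Proof. by rewrite prjD opprD addrACA. Qed.

Lemma prj_subZ jp c (Y : mtx) : opposite_part jp (c *: Y) - c *: Y = c *: (opposite_part jp Y - Y).
Proof. by rewrite prjZ scalerBr. Qed.

Lemma prj_graph jp (x y : word) : opposite_part jp (mp (graph x y)) =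
  (opposite jp x y)%:R *: mp (graph x y).
Proof.
have [e mpE] := mp_graph F par x y; rewrite mpE prjZ scalerA mulrC -scalerA; congr (_ *: _).
apply: entP => x' y'; rewrite ent_prj entZ ent_mono.
case: (y' =P y) => [->|_]; last by rewrite !mul0r !mulr0.
by case: (x' =P x) => [->|_] //; rewrite !mulr0.
Qed.

Lemma adwD w (Y Z : mtx) : sad_word par w (Y + Z) = sad_word par w Y + sad_word par w Z.
Proof. by elim: w => //= a w ->; rewrite adD. Qed.

Lemma adwZ w c (Y : mtx) : sad_word par w (c *: Y) = c *: sad_word par w Y.
Proof. by elim: w => //= a w ->; rewrite adZ. Qed.

Section Leading.
Variable jp : T -> bool.
Hypothesis char0 : forall n, (n%:R == 0 :> F) = (n == 0)%N.
Local Notation jj := (@J_op F T jp d).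
Local Notation prj := (@opposite_part F T jp d).

Lemma prj_adw_sum (J : eqType) (r : seq J) (c : J -> F) (w : J -> seq Gn) :
  (forall i, i \in r -> size (w i) <= d)%N ->
  prj (\sum_(i <- r) c i *: sad_word par (w i) jj) =
  2%:R ^+ d *: (prj (\sum_(i <- r) c i *: (if size (w i) == d then placements F par d (w i) else 0)) *m jj).
Proof.
move=> wd; rewrite !prj_sum mulmx_suml scaler_sumr !big_seq.
apply: eq_bigr => i ir; rewrite !prjZ prj_adw ?wd // scalerA mulrC -scalerA -scalemxAl.
congr (_ *: (_ *: _)); case: ifP => // _.
by have := prjZ jp 0 (0 : mtx); rewrite !scale0r => ->; rewrite mul0mx.
Qed.

(** [ad b] commutes with [prj], and the invertible [jj] cancels, which leaves commutation twisted by
    parity. The letters [(i, i)] are even and carry no twist; commuting with them makes [M] even,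
    and the twist disappears for all [b]. *)
Lemma leading_commutes (Y M : mtx) : prj Y = 2%:R ^+ d *: (M *m jj) ->
  (forall b, ~~ side_change jp b -> ad b Y = 0) ->
  forall b, ~~ side_change jp b -> M *m delta b = delta b *m M.
Proof.
move=> YM adY.
have sgmM_comm b : ~~ side_change jp b -> sgm (gp b) M *m delta b = delta b *m M.
  move=> Kb; have : ad b (prj Y) = 0.
    rewrite -prj_ad // adY //.
    by have := prjZ jp 0 (0 : mtx); rewrite !scale0r.
  rewrite YM adZ => /eqP; rewrite scaler_eq0 expf_eq0 char0 andbF /=.
  rewrite /sad sgmM sgm_jj -(mulmxA _ jj) jj_delta // !mulmxA -mulmxBl => /eqP adM.
  have := congr1 (mulmx^~ jj) adM; rewrite mul0mx -mulmxA jj_sq mulmx1 => /eqP.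
  by rewrite subr_eq0 => /eqP.
have Mi i : M *m delta (i, i) = delta (i, i) *m M.
  have := sgmM_comm (i, i); rewrite /gen_par /side_change /= !addbb /=.
  by apply.
by move=> b Kb; rewrite -sgmM_comm // sgm_weight0.
Qed.

End Leading.

Definition bracket_terms (a b : Gn) : seq (F * Gn) :=
  [:: ((a.2 == b.1)%:R, (a.1, b.2)); (- (sg (gp a && gp b) * (b.2 == a.1)%:R), (b.1, a.2))].

(** The Leibniz expansion is kept as a formal list, to be read both as operators ([ad_mp_adl]) and
    as words in U ([sbr_XS]). *)
Fixpoint sad_terms (a : Gn) (u : seq slot) : seq (F * seq slot) :=
  if u is x :: v then
    [seq (t.1, (x.1, t.2) :: v) | t <- bracket_terms a x.2] ++
    [seq (sg (gp a && gp x.2) * t.1, x :: t.2) | t <- sad_terms a v]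
  else [::].

Lemma slots_adl a u t : t \in sad_terms a u -> slots t.2 = slots u.
Proof.
elim: u t => // x u IH t; rewrite mem_cat => /orP[] /mapP[t' t'u ->] //=.
by rewrite (IH t').
Qed.

Lemma ad_mp_adl a u : ad a (mp u) = \sum_(t <- sad_terms a u) t.1 *: mp t.2.
Proof.
elim: u => [|x u IH] /=.
  by rewrite big_nil /sad mulmx1 (@sgm_mp F T par d (gp a) [::]) /= andbF scale1r mul1mx subrr.
rewrite !big_cons big_map addrA /=.
have -> : ad a (E x.1 x.2 *m mp u) =
    (delta a *m E x.1 x.2 - sg (gp a && gp x.2) *: (E x.1 x.2 *m delta a)) *m mp u
    + sg (gp a && gp x.2) *: (E x.1 x.2 *m ad a (mp u)).
  rewrite /sad sgmM sgm_E mulmxBl mulmxBr scalerBr -!scalemxAl !mulmxA.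
  by rewrite addrA subrK.
rewrite E_br IH mulmxBl -!scalemxAl scaleNr; congr (_ + _).
rewrite mulmx_sumr scaler_sumr; apply: eq_bigr => t _.
by rewrite -scalemxAr scalerA.
Qed.

Lemma ad_rp (char0 : forall n, (n%:R == 0 :> F) = (n == 0)%N) a s : ad a (rp s) = 0.
Proof.
rewrite /sad sgm_weight0 ?rp_delta ?subrr // => i.
by rewrite rp_delta.
Qed.

End Coordinates.

Lemma C_char0 n : (n%:R == 0 :> C) = (n == 0)%N.
Proof. exact: (@Num.Theory.pnatr_eq0 (complex Rdefinitions.R)). Qed.

Lemma subDD (V : zmodType) (x y z t : V) : x + y - (z + t) = (x - z) + (y - t).
Proof. by rewrite opprD addrACA. Qed.

Lemma lin_aux (A : lalgType C) (g x y z : A) a b :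
  g * z - (a *: (x * z) + b *: (y * z)) = (g - (a *: x + b *: y)) * z.
Proof. by rewrite mulrBl mulrDl -!scalerAl. Qed.

(** * From operators to the enveloping algebra *)

Section Enveloping.
Variables (p q d : nat).
Local Notation Idx := (Idx p q).
Local Notation Gen := (Gen p q).
Local Notation FA := (FA p q).
Local Notation I := (@Iideal p q).
Local Notation X := (@Defs.X p q).
Local Notation XX := (@Xword p q).
Local Notation slot := ('I_d * Gen)%type.
Local Notation mtx := 'M[C]_#|{ffun 'I_d -> Idx}|.
Local Notation ipar := (@ipar p q).
Local Notation Jpos := (@Jpos p q).
Local Notation gpar := (@gpar p q).
Local Notation low := (@low p q).
Local Notation lowI := (@lowI p q).
Local Notation mp := (@slot_prod C Idx ipar d).
Local Notation rp := (@perm_op C Idx ipar d).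
Local Notation ad := (@sad C Idx ipar d).
Local Notation prj := (@opposite_part C Idx Jpos d).
Local Notation E := (@unit_op C Idx ipar d).
Local Notation slots u := [seq x.1 | x <- u].

Definition Xslots (u : seq slot) : FA := XX [seq x.2 | x <- u].
Local Notation XS := Xslots.

Lemma mp_cons x u : mp (x :: u) = E x.1 x.2 *m mp u. Proof. by []. Qed.

Lemma XS_cons x u : XS (x :: u) = X x.2 * XS u.
Proof. exact: XX_cons. Qed.

Lemma size_XS (u : seq slot) : size [seq x.2 | x <- u] = size u.
Proof. exact: size_map. Qed.

Lemma move_front x u v : x.1 \notin slots u -> exists e : bool,
  mp (x :: u ++ v) = sgn e *: mp (u ++ x :: v) /\
  lowI (size (x :: u ++ v)) (XS (x :: u ++ v) - sgn e *: XS (u ++ x :: v)).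
Proof.
elim: u => [_|y u IH].
  exists false; rewrite !scale1r; split=> //; rewrite subrr.
  exact/lowI_filt/filt0.
rewrite inE negb_or => /andP[xy xu]; have [e [mpE XE]] := IH xu.
pose c := gpar x.2 && gpar y.2.
exists (c (+) e); split.
  rewrite !cat_cons !mp_cons mulmxA E_comm // -scalemxAl -mulmxA -mp_cons mpE.
  by rewrite -scalemxAr scalerA -sgnD.
rewrite !cat_cons; apply: (@lowI_trans _ _ _ (sgn c *: XS (y :: x :: u ++ v))).
  have := lowI_swap x.2 y.2 [seq z.2 | z <- u ++ v].
  by rewrite size_XS !XS_cons.
have -> : sgn c *: XS (y :: x :: u ++ v) - sgn (c (+) e) *: XS (y :: u ++ x :: v) =
    sgn c *: (X y.2 * (XS (x :: u ++ v) - sgn e *: XS (u ++ x :: v))).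
  by rewrite mulrBr FAscaleAr scalerBr scalerA -sgnD !XS_cons.
exact/lowIZ/lowI_Ml.
Qed.

(** One sign serves both sides: operators in distinct slots supercommute exactly, letters in U
    modulo shorter words. This agreement makes [phi] independent of the order of the slots up to
    lower terms. *)
Lemma reorder u v : perm_eq u v -> uniq (slots u) -> exists e : bool,
  mp u = sgn e *: mp v /\ lowI (size u) (XS u - sgn e *: XS v).
Proof.
elim: u v => [|x u IH] v.
  rewrite perm_sym => /perm_nilP -> _; exists false; rewrite !scale1r subrr.
  by split=> //; apply/lowI_filt/filt0.
move=> uv /andP[xu uu]; have xv : x \in v by rewrite -(perm_mem uv) mem_head.
have [v1 [v2 vE]] : exists v1 v2, v = v1 ++ x :: v2.
  by case/splitPr: xv => v1 v2; exists v1, v2.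
move: uv; rewrite vE.
rewrite perm_sym perm_catC cat_cons perm_cons perm_catC perm_sym => uv.
have [e [mpE XE]] := IH _ uv uu.
have [|e' [mpE' XE']] := @move_front x v1 v2.
  apply: contra xu => xv1; rewrite (perm_mem (perm_map fst uv)) map_cat mem_cat.
  by rewrite xv1.
exists (e (+) e'); split; first by rewrite mp_cons mpE -scalemxAr -mp_cons mpE' scalerA -sgnD.
apply: (@lowI_trans _ _ _ (sgn e *: XS (x :: v1 ++ v2))).
  rewrite !XS_cons -FAscaleAr -mulrBr.
  exact: (lowI_Ml x.2 XE).
rewrite sgnD -scalerA -scalerBr; apply: lowIZ.
by move: XE'; rewrite /= (perm_size uv).
Qed.

Local Notation phi := (@Phi C Idx ipar d FA (fun x y => XS (graph x y))).

Lemma phi_slots_enum u : slots u = enum 'I_d -> phi (mp u) = XS u.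
Proof. by case/slots_enum => x [y ->]; rewrite Phi_graph. Qed.

Lemma size_graph x y : size (@graph Idx d x y) = d.
Proof. by rewrite size_map size_enum_ord. Qed.

Lemma phi_mp u : perm_eq (slots u) (enum 'I_d) -> low d (phi (mp u) - XS u).
Proof.
move=> su; have uu : uniq (slots u) by rewrite (perm_uniq su) enum_uniq.
have [x [y uxy]] := slots_perm su; have [e [mpE XE]] := reorder uxy uu.
rewrite mpE PhiZ Phi_graph -opprB; apply/lowN/lowI_low.
by move: XE; rewrite (perm_size uxy) size_graph.
Qed.

Let mtx_indC := @mtx_ind C Idx ipar d.

(** Conjugation relabels the slots of a basis product without moving its letters, so its word stays
    the same and [phi_mp] compares the two. *)
Lemma phi_conj c Y : low d (phi (rp c *m Y *m rp c^-1%g - Y)).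
Proof.
elim/mtx_indC: Y => [|Y Z lY lZ|a Y lY|x y].
- rewrite mulmx0 mul0mx subrr Phi0; exact: low0.
- rewrite conj_subD PhiD; exact: lowD lY lZ.
- rewrite conj_subZ PhiZ; exact: lowZ lY.
set u := graph x y; pose u' := [seq (c^-1%g z.1, z.2) | z <- u].
have u'u : [seq (c z.1, z.2) | z <- u'] = u.
  by rewrite -map_comp -[RHS]map_id; apply: eq_map => -[k b] /=; rewrite permKV.
have -> : rp c *m mp u *m rp c^-1%g = mp u'.
  by rewrite -{1}u'u rp_mp -mulmxA rpV mulmx1.
have XSu' : XS u' = XS u by rewrite /XS -map_comp.
rewrite PhiB Phi_graph -/u -XSu'; apply: phi_mp.
have -> : slots u' = [seq c^-1%g k | k <- enum 'I_d].
  by rewrite -(slots_graph x y) -!map_comp.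
apply: uniq_perm; [by rewrite (map_inj_uniq (@perm_inj _ c^-1%g)) enum_uniq | exact: enum_uniq |].
move=> k; rewrite mem_enum; apply/mapP; exists (c k); rewrite ?mem_enum //.
by rewrite permK.
Qed.

(** A basis product that is not opposite contains a letter of k; modulo shorter words that letter
    moves to the right end, and the word falls into Uk. *)
Lemma phi_prj Y : low d (phi (prj Y - Y)).
Proof.
elim/mtx_indC: Y => [|Y Z lY lZ|a Y lY|x y].
- have -> : prj 0 = 0 by have := prjZ Jpos 0 (0 : mtx); rewrite !scale0r.
  rewrite subrr Phi0; exact: low0.
- rewrite prj_subD PhiD; exact: lowD lY lZ.
- rewrite prj_subZ PhiZ; exact: lowZ lY.
rewrite prj_graph; case: (boolP (opposite Jpos x y)) => [_|].
  rewrite scale1r subrr Phi0; exact: low0.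
rewrite negb_forall => /existsP[k /negPn/eqP kK].
rewrite scale0r sub0r -scaleN1r PhiZ Phi_graph; apply: lowZ.
have kg : (k, (x k, y k)) \in graph x y by apply/mapP; exists k; rewrite ?mem_enum.
have pg : perm_eq (graph x y) (rcons (rem (k, (x k, y k)) (graph x y)) (k, (x k, y k))).
  by rewrite perm_sym perm_rcons perm_sym; apply: perm_to_rem.
have [|f [_ XE]] := reorder pg; first by rewrite slots_graph enum_uniq.
rewrite -(subrK (sgn f *: XS (rcons (rem (k, (x k, y k)) (graph x y)) (k, (x k, y k)))) (XS (graph x y))).
apply: lowD; first by apply: lowI_low; move: XE; rewrite size_graph.
apply/lowZ/low_UK; rewrite /XS map_rcons -cats1 XX_cat /=.
rewrite -[XX [:: _]]mulr1 /Xword big_seq1 mulr1.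
by apply: UK_mulX; rewrite /inK /= kK.
Qed.

Lemma sbr_XS a u : I (sbr a (XS u) - \sum_(t <- sad_terms C ipar a u) t.1 *: XS t.2).
Proof.
elim: u => [|x u IH].
  by rewrite sbr1 big_nil subrr; apply: Iideal0.
rewrite [sad_terms _ _ _ _]/= !big_cons big_map /=.
rewrite -(subrK (glbr a x.2 * XS u + sgn (gpar a && gpar x.2) *: (X x.2 * sbr a (XS u))) (sbr a _)).
rewrite -addrA; apply: idealD; first exact: sbr_cons.
set S := \sum_(t <- _) _.
have -> : S = sgn (gpar a && gpar x.2) *: (X x.2 * \sum_(t <- sad_terms C ipar a u) t.1 *: XS t.2).
  rewrite mulr_sumr scaler_sumr; apply: eq_bigr => t _.
  by rewrite FAscaleAr XS_cons scalerA.
rewrite !XS_cons /= [_ *: _ + (_ + _)]addrA opprD addrACA; apply: idealD; last first.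
  by rewrite -scalerBr -mulrBr; apply/idealZ/idealMl.
rewrite lin_aux; apply: idealMr.
suff -> : glbr a x.2 = (a.2 == x.2.1)%:R *: X (a.1, x.2.2) -
   (sgn (gpar a && gpar x.2) * (x.2.2 == a.1)%:R) *: X (x.2.1, a.2).
  by rewrite scaleNr subrr; apply: Iideal0.
rewrite /glbr -scalerA.
by case: (a.2 == _); case: (x.2.2 == _); rewrite ?scale1r ?scale0r ?scaler0.
Qed.

(** Equivariance is exact in U because the Leibniz expansion keeps the slots in increasing order,
    where [phi] needs no reordering. *)
Lemma sbr_phi a Y : I (sbr a (phi Y) - phi (ad a Y)).
Proof.
elim/mtx_indC: Y => [|Y Z IY IZ|c Y IY|x y].
- have := @adZ C Idx ipar d a 0 0; rewrite !scale0r => ->.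
  by rewrite Phi0 sbr0 subrr; apply: Iideal0.
- rewrite adD (PhiD _ _ Y Z) (PhiD _ _ (ad a Y)) sbrD subDD; exact: idealD IY IZ.
- rewrite adZ (PhiZ _ _ c Y) (PhiZ _ _ c (ad a Y)) sbrZ -scalerBr; exact: idealZ IY.
rewrite Phi_graph ad_mp_adl Phi_sum.
have -> : \sum_(t <- sad_terms C ipar a (graph x y)) phi (t.1 *: mp t.2) =
          \sum_(t <- sad_terms C ipar a (graph x y)) t.1 *: XS t.2.
  rewrite !big_seq; apply: eq_bigr => t tu.
  by rewrite PhiZ phi_slots_enum // (slots_adl tu) slots_graph.
exact: sbr_XS.
Qed.

Lemma inZ_phi_rp s : inZ (phi (rp s)).
Proof.
move=> a; have := sbr_phi a (rp s).
by rewrite (ad_rp ipar C_char0) Phi0 subr0.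
Qed.

End Enveloping.

(** * The action of U on operators and the leading term *)

Section Action.
Variables (p q d : nat).
Local Notation Idx := (Idx p q).
Local Notation Gen := (Gen p q).
Local Notation FA := (FA p q).
Local Notation I := (@Iideal p q).
Local Notation X := (@Defs.X p q).
Local Notation XX := (@Xword p q).
Local Notation mtx := 'M[C]_#|{ffun 'I_d -> Idx}|.
Local Notation ipar := (@ipar p q).
Local Notation Jpos := (@Jpos p q).
Local Notation gpar := (@gpar p q).
Local Notation low := (@low p q).
Local Notation ad := (@sad C Idx ipar d).
Local Notation adw := (@sad_word C Idx ipar d).
Local Notation prj := (@opposite_part C Idx Jpos d).
Local Notation jj := (@J_op C Idx Jpos d).
Local Notation place := (@placements C Idx ipar d).
Local Notation XS := (@Xslots p q d).
Local Notation phi := (@Phi C Idx ipar d FA (fun x y => XS (graph x y))).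
Local Notation Urel := (@Urel p q).
Local Notation glbr := (@glbr p q).
Local Notation inUK := (@inUK p q).
Local Notation inUk_inv := (@inUk_inv p q).
Local Notation inZ := (@inZ p q).

Definition act (f : FA) (Y : mtx) : mtx := mlin (fun w => adw w Y) f.

Lemma actD f g Y : act (f + g) Y = act f Y + act g Y. Proof. exact: mlinD. Qed.
Lemma actZ c f Y : act (c *: f) Y = c *: act f Y. Proof. exact: mlinZ. Qed.
Lemma act0 Y : act 0 Y = 0. Proof. exact: mlin0. Qed.
Lemma actN f Y : act (- f) Y = - act f Y.
Proof. by rewrite -(scaleN1r f) actZ scaleN1r. Qed.
Lemma actB f g Y : act (f - g) Y = act f Y - act g Y.
Proof. by rewrite actD actN. Qed.
Lemma act_XX s Y : act (XX s) Y = adw s Y. Proof. exact: mlinXX. Qed.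

Lemma actX a Y : act (X a) Y = ad a Y.
Proof.
have -> : X a = XX [:: a] by rewrite /Xword big_seq1.
by rewrite act_XX.
Qed.

Lemma act_r0 f : act f 0 = 0.
Proof.
rewrite /act /mlin big1 // => w _.
by have := adwZ ipar w 0 (0 : mtx); rewrite !scale0r => ->; rewrite scaler0.
Qed.

Lemma actM f g Y : act (f * g) Y = act f (act g Y).
Proof.
apply: (FA_ext (u := fun f => act (f * g) Y) (v := fun f => act f (act g Y))) => [h k|c h|h k|c h|s].
- by rewrite mulrDl actD.
- by rewrite -scalerAl actZ.
- exact: actD.
- exact: actZ.
rewrite act_XX.
apply: (FA_ext (u := fun g => act (XX s * g) Y) (v := fun g => adw s (act g Y))) => [h k|c h|h k|c h|t].
- by rewrite mulrDr actD.
- by rewrite FAscaleAr actZ.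
- by rewrite actD adwD.
- by rewrite actZ adwZ.
by rewrite -XX_cat !act_XX /sad_word foldr_cat.
Qed.

Lemma act_Urel a b Y : act (Urel a b) Y = 0.
Proof.
have XXE c c' : act (X c * X c') Y = ad c (ad c' Y).
  by rewrite (actM (X c)) (actX c') (actX c).
have gE : act (glbr a b) Y = (a.2 == b.1)%:R *: ad (a.1, b.2) Y -
    (sgn (gpar a && gpar b) * (b.2 == a.1)%:R) *: ad (b.1, a.2) Y.
  rewrite actB actZ -scalerA; congr (_ - _ *: _).
    by case: (a.2 == b.1); [rewrite actX scale1r | rewrite act0 scale0r].
  by case: (b.2 == a.1); [rewrite actX scale1r | rewrite act0 scale0r].
set e := sgn _ in gE *.
have -> : act (Urel a b) Y = act (X a * X b) Y - e *: act (X b * X a) Y - act (glbr a b) Y.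
  transitivity (act (X a * X b - e *: (X b * X a)) Y - act (glbr a b) Y).
    exact: (actB (X a * X b - e *: (X b * X a)) (glbr a b) Y).
  by congr (_ - _); rewrite -(actZ e); exact: actB.
apply: (etrans (congr2 (fun U W => U - W)
  (congr2 (fun U W => U - e *: W) (XXE a b) (XXE b a)) gE)).
apply: (etrans (congr1 (fun Z => Z - _) (ad_br ipar a b Y))).
exact: subrr.
Qed.

Lemma act_ideal f Y : I f -> act f Y = 0.
Proof.
elim=> [|g h a b|x y _ x0 _ y0]; first exact: act0.
  by rewrite actM actM act_Urel act_r0.
by rewrite actD x0 y0 addr0.
Qed.

Lemma inK_jx a : inK a = ~~ side_change Jpos a.
Proof. by rewrite /inK /side_change negb_add. Qed.

Lemma act_UK f : inUK f -> act f jj = 0.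
Proof.
case=> g If; rewrite -(subrK (\sum_(a | inK a) g a * X a) f) actD act_ideal // add0r.
rewrite /act mlin_sum big1 // => a; rewrite inK_jx => Ka.
by rewrite -/(act _ _) actM actX ad_jj // act_r0.
Qed.

(** [X b * u] differs from [sbr b u], which lies in the ideal, by a product ending in [X b], which
    kills [jj]. *)
Lemma ad_act_inv u b : inUk_inv u -> inK b -> ad b (act u jj) = 0.
Proof.
move=> uinv Kb; pose u' := if gpar b then parity_aut u else u.
have u'0 : act (u' * X b) jj = 0.
  by rewrite (actM u') (actX b) ad_jj -?inK_jx // act_r0.
have bu : ad b (act u jj) = act (X b * u) jj by rewrite (actM (X b)) (actX b).
rewrite bu -[LHS]subr0 -[X in _ - X]u'0.
apply: (etrans (esym (actB (X b * u) (u' * X b) jj))).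
exact: (act_ideal jj (uinv b Kb)).
Qed.

(** With [d] letters every placement fills all slots, so each summand gives back [XX w] modulo
    shorter words. *)
Lemma phi_place (w : seq Gen) : size w = d ->
  low d (phi (place w) - (size (injections d d))%:R *: XX w).
Proof.
move=> wd; rewrite /placements wd Phi_sum scaler_nat.
have -> : XX w *+ size (injections d d) = \sum_(ks <- injections d d) XX w.
  by rewrite big_const_seq count_predT iter_addr_0.
rewrite -sumrB; apply: low_sum => ks /injectionsP[uks sks] _.
have -> : XX w = XS (zip ks w) by rewrite /XS -/(unzip2 _) unzip2_zip // sks wd.
apply: phi_mp; rewrite slots_zip ?sks ?wd //.
apply: uniq_perm; rewrite ?enum_uniq //.
have [||_ //] := uniq_min_size uks (s2 := enum 'I_d).
  by move=> k _; rewrite mem_enum.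
by rewrite size_enum_ord sks.
Qed.

Lemma inZD z z' : inZ z -> inZ z' -> inZ (z + z').
Proof. by move=> Zz Zz' a; rewrite sbrD; exact: idealD (Zz a) (Zz' a). Qed.

Lemma inZZ c z : inZ z -> inZ (c *: z).
Proof. by move=> Zz a; rewrite sbrZ; exact: idealZ (Zz a). Qed.

Lemma inZ0 : inZ 0.
Proof. by move=> a; rewrite sbr0; exact: Iideal0. Qed.

Lemma leading_central u : inUk_inv u -> low d.+1 u ->
  exists z, inZ z /\ low d (u - z).
Proof.
move=> uinv [v Fv Kv]; pose N : C := (size (injections d d))%:R.
have N0 : N != 0 by rewrite /N C_char0 -lt0n injections_neq0.
(* Only the words of top length [d] enter; [phi M0] is then [N *: v] modulo lower terms. *)
pose M0 : mtx := \sum_(w <- msupp v) v@_w *: (if size (w : seq Gen) == d then place w else 0).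
have uv : act u jj = act v jj by rewrite -(subrK v u) actD (act_UK Kv) add0r.
have prj_v : prj (act v jj) = 2%:R ^+ d *: (prj M0 *m jj).
  have vd (w : {fmonom Gen}) : w \in (msupp v : seq _) -> (size (w : seq Gen) <= d)%N.
    by move=> wv; rewrite -ltnS; exact: filt_supp Fv wv.
  exact: (prj_adw_sum ipar Jpos (fun w => v@_w) vd).
have Mcomm : forall b, ~~ side_change Jpos b -> prj M0 *m total_op C ipar d b = total_op C ipar d b *m prj M0.
  apply: (leading_commutes C_char0 prj_v) => b Kb.
  by rewrite -uv; apply: ad_act_inv; rewrite ?inK_jx.
have [c Mc] := commutant_span C_char0 Mcomm.
have QD (Y Z : mtx) : low d (phi Y) -> low d (phi Z) -> low d (phi (Y + Z)).
  by move=> lY lZ; rewrite PhiD; exact: lowD lY lZ.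
have QZ a (Y : mtx) : low d (phi Y) -> low d (phi (a *: Y)).
  by move=> lY; rewrite PhiZ; exact: lowZ lY.
have [c' lc'] := span_rp_mod C_char0 QD QZ (@phi_conj p q d) (@phi_prj p q d) Mc (prj_idem _ _).
set S := \sum_s _ in lc'.
exists (N^-1 *: phi S); split.
  apply: inZZ; rewrite /S Phi_sum; apply: big_ind => [||s _]; first exact: inZ0.
    exact: inZD.
  by rewrite PhiZ; apply/inZZ/inZ_phi_rp.
(* Modulo [low d], [u] agrees with [v], and [N *: v] agrees in turn with [phi M0], [phi (prj M0)]
   and [phi S]. *)
apply: (@low_trans _ _ _ v); first exact: low_UK.
have -> : v - N^-1 *: phi S = N^-1 *: (N *: v - phi S).
  by rewrite scalerBr scalerA mulVf // scale1r.
apply: lowZ; apply: (@low_trans _ _ _ (phi M0)).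
  rewrite -opprB; apply: lowN; rewrite {1}(FAE v) scaler_sumr /M0 Phi_sum -sumrB.
  apply: low_sum => w wv _; rewrite PhiZ scalerA mulrC -scalerA -scalerBr; apply: lowZ.
  case: eqP => [/phi_place //|/eqP wd].
  rewrite Phi0 sub0r; apply/lowN/lowZ/low_filt/filt_XX.
  by rewrite ltn_neqAle wd -ltnS; exact: filt_supp Fv wv.
apply: (@low_trans _ _ _ (phi (prj M0))); last by rewrite -PhiB.
by rewrite -PhiB -opprB -scaleN1r PhiZ; apply/lowZ/phi_prj.
Qed.

End Action.

(** * Descent along the filtration *)

Lemma low0_UK p q (u : FA p q) : low 0 u -> inUK u.
Proof.
case=> y Fy Ky; suff y0 : y = 0 by move: Ky; rewrite y0 subr0.
apply/malgP=> w; rewrite mcoeff0; apply/eqP; apply: contraT => /Fy.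
by rewrite ltn0.
Qed.

Lemma inUk_invB p q (u z : FA p q) : inUk_inv u -> inZ z -> inUk_inv (u - z).
Proof.
move=> uinv Zz a Ka; rewrite sbrD -(scaleN1r z) sbrZ.
exact: idealD (uinv a Ka) (idealZ _ (Zz a)).
Qed.

(** Subtracting a central element keeps k-invariance, so the leading part can be stripped off again
    until degree 0, where the remainder lies in Uk. *)
Lemma central_lift p q n (u : FA p q) : inUk_inv u -> low n u ->
  exists z, inZ z /\ inUK (u - z).
Proof.
elim: n u => [|d IH] u uinv lu.
  by exists 0; split; [exact: inZ0 | rewrite subr0; exact: low0_UK].
have [z [Zz lz]] := leading_central uinv lu.
have [z' [Zz' Kz']] := IH _ (inUk_invB uinv Zz) lz.
exists (z + z'); split; first exact: inZD.
by rewrite opprD addrA.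
Qed.

Theorem theoremB (p q : nat) (hp : (1 <= p)%N) (hq : (1 <= q)%N) :
  pi_surjective p q.
Proof.
move=> u uinv.
have [n Fu] : exists n, filt n u.
  (* One more than the longest length, since [filt] is strict. *)
  exists (\max_(w <- msupp u) (size (w : seq (Gen p q))).+1) => w.
  rewrite mcoeff_neq0 => wu.
  apply: (@leq_bigmax_seq _ _ xpredT (fun w : {fmonom Gen p q} => (size (w : seq (Gen p q))).+1) w) => //.
have [z [Zz Kz]] := central_lift uinv (low_filt Fu).
exists z; exact: (conj Zz (conj (inUk_invB uinv Zz) Kz)).
Qed.
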